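(* Let $q>4$ be a prime power with $q\ne9$, let $G=\mathrm{PSL}(2,q)$, and let $X$ be a non-trivial conjugacy class of $G$. (1) The Schur multiplier of $G$ relative to $X$ is (a) the trivial group if $q$ is even, (b) the trivial group if $q$ is odd and $X$ is the class of involutions, (c) the cyclic group of order two if $q$ is odd and $X$ is not the class of involutions. (2) The associated group $\mathrm{As}(X)$ of $X$ is isomorphic to (a) the group $\mathrm{SL}(2,q)\times\mathbb{Z}$ if $q$ is even or $X$ is not the class of involutions, (b) $\mathrm{PSL}(2,q)\times\mathbb{Z}$ if $q$ is odd and $X$ is the class of involutions.
   Context: $X$ is a rack via $x\triangleright y=xyx^{-1}$. Let $F_X$ be the free group on symbols $g_x$, $x\in X$. The associated group is $\mathrm{As}(X)=F_X/R_0$, where $R_0$ is the normal closure of all $g_xg_yg_x^{-1}g_{x\triangleright y}^{-1}$, $x,y\in X$. Relative Schur multiplier: let $G$ be a perfect group generated by a conjugacy class $X$ (for $q>3$, $\mathrm{PSL}(2,q)$ is simple, so this applies). Let $\pi:F_X\to G$, $g_x\mapsto x$, and $R_X=\ker\pi$. The Schur multiplier is $M(G)=(R_X\cap[F_X,F_X])/[F_X,R_X]$. For $x\in X$ let $\mu_x:C_G(x)\to M(G)$ be the group homomorphism with $\mu_x(g)=hyh^{-1}y^{-1}$ for any preimages $h$ of $g$ and $y$ of $x$ under the map $F_X/[F_X,R_X]\to G$ induced by $\pi$. The subgroup $\mu_x(C_G(x))$ does not depend on $x\in X$, and the Schur multiplier of $G$ relative to $X$ is $M(G)/\mu_x(C_G(x))$.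 For each $q$, $\mathrm{PSL}(2,q)$ has exactly one class of involutions. *)

(* Defs.v *)
From HB Require Import structures.
From mathcomp Require Import all_boot all_order all_algebra all_fingroup.
From mathcomp Require Import center boolp.
Set Implicit Arguments.
Unset Strict Implicit.
Unset Printing Implicit Defensive.

Import GroupScope.

(** Groups are [groupType]s, not necessarily finite; their subgroups are
    predicates with a [groupClosed] structure. *)

HB.mixin Record isConjClosed (G : groupType) (S : {pred G}) := {
  gpredJn : forall x y : G, x \in S -> x ^ y \in S
}.

#[short(type="normalClosed")]
HB.structure Definition NormalClosed (G : groupType) :=
  {S of isConjClosed G S & GroupClosed G S}.

Definition full_pred (G : groupType) : {pred G} := fun=> true.

Section FullPred.
Variable G : groupType.
HB.instance Definition _ := isMulClosed.Build G (@full_pred G)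
  (fun _ _ _ _ => isT).
HB.instance Definition _ := isMul1Closed.Build G (@full_pred G) isT.
HB.instance Definition _ := isInvClosed.Build G (@full_pred G)
  (fun _ _ => isT).
HB.instance Definition _ := isConjClosed.Build G (@full_pred G)
  (fun _ _ _ => isT).
End FullPred.

Section Kernel.
Variables (G H : groupType) (f : UMagmaMorphism.type G H).

Definition ker_pred : {pred G} := fun x => f x == 1.

Fact ker_predM : mulg_closed ker_pred.
Proof.
by move=> x y; rewrite !unfold_in gmulfM => /eqP-> /eqP->; rewrite mulg1.
Qed.
Fact ker_pred1 : 1 \in ker_pred.
Proof. by rewrite unfold_in gmulf1. Qed.
Fact ker_predV : invg_closed ker_pred.
Proof. by move=> x; rewrite !unfold_in gmulfV => /eqP->; rewrite invg1. Qed.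
Fact ker_predJ x y : x \in ker_pred -> x ^ y \in ker_pred.
Proof. by rewrite !unfold_in gmulfJ => /eqP->; rewrite conj1g. Qed.
HB.instance Definition _ := isMulClosed.Build G ker_pred ker_predM.
HB.instance Definition _ := isMul1Closed.Build G ker_pred ker_pred1.
HB.instance Definition _ := isInvClosed.Build G ker_pred ker_predV.
HB.instance Definition _ := isConjClosed.Build G ker_pred ker_predJ.
End Kernel.

Section CapPred.
Variables (G : groupType) (S T : normalClosed G).

Definition cap_pred : {pred G} := fun x => (x \in S) && (x \in T).

Fact cap_predM : mulg_closed cap_pred.
Proof.
by move=> x y /andP[xS xT] /andP[yS yT]; apply/andP; rewrite !gpredM.
Qed.
Fact cap_pred1 : 1 \in cap_pred.
Proof. by apply/andP; rewrite !gpred1. Qed.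
Fact cap_predV : invg_closed cap_pred.
Proof. by move=> x /andP[xS xT]; apply/andP; rewrite !gpredVr. Qed.
Fact cap_predJ x y : x \in cap_pred -> x ^ y \in cap_pred.
Proof. by move=> /andP[xS xT]; apply/andP; rewrite !gpredJn. Qed.
HB.instance Definition _ := isMulClosed.Build G cap_pred cap_predM.
HB.instance Definition _ := isMul1Closed.Build G cap_pred cap_pred1.
HB.instance Definition _ := isInvClosed.Build G cap_pred cap_predV.
HB.instance Definition _ := isConjClosed.Build G cap_pred cap_predJ.
End CapPred.

Section Generation.
Variables (G : groupType) (A : {pred G}).

Definition gen_pred : {pred G} :=
  fun x => `[< forall S : groupClosed G, {subset A <= S} -> x \in S >].

Definition normal_closure : {pred G} :=
  fun x => `[< forall S : normalClosed G, {subset A <= S} -> x \in S >].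

Fact gen_predM : mulg_closed gen_pred.
Proof.
move=> x y; rewrite !unfold_in => /asboolP xA /asboolP yA.
by apply/asboolP => S AS; rewrite gpredM ?xA ?yA.
Qed.
Fact gen_pred1 : 1 \in gen_pred.
Proof. by rewrite unfold_in; apply/asboolP => S AS; apply: gpred1. Qed.
Fact gen_predV : invg_closed gen_pred.
Proof.
move=> x; rewrite !unfold_in => /asboolP xA.
by apply/asboolP => S AS; rewrite gpredVr ?xA.
Qed.
HB.instance Definition _ := isMulClosed.Build G gen_pred gen_predM.
HB.instance Definition _ := isMul1Closed.Build G gen_pred gen_pred1.
HB.instance Definition _ := isInvClosed.Build G gen_pred gen_predV.

Fact normal_closureM : mulg_closed normal_closure.
Proof.
move=> x y; rewrite !unfold_in => /asboolP xA /asboolP yA.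
by apply/asboolP => S AS; rewrite gpredM ?xA ?yA.
Qed.
Fact normal_closure1 : 1 \in normal_closure.
Proof. by rewrite unfold_in; apply/asboolP => S AS; apply: gpred1. Qed.
Fact normal_closureV : invg_closed normal_closure.
Proof.
move=> x; rewrite !unfold_in => /asboolP xA.
by apply/asboolP => S AS; rewrite gpredVr ?xA.
Qed.
Fact normal_closureJ x y : x \in normal_closure -> x ^ y \in normal_closure.
Proof.
rewrite !unfold_in => /asboolP xA.
by apply/asboolP => S AS; rewrite gpredJn ?xA.
Qed.
HB.instance Definition _ := isMulClosed.Build G normal_closure normal_closureM.
HB.instance Definition _ := isMul1Closed.Build G normal_closure normal_closure1.
HB.instance Definition _ := isInvClosed.Build G normal_closure normal_closureV.
HB.instance Definition _ :=
  isConjClosed.Build G normal_closure normal_closureJ.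
End Generation.

Section ConjPreim.
Variables (G : groupType) (S : groupClosed G) (y : G).

Definition conj_preim : {pred G} := fun x => x ^ y \in S.

Fact conj_preimM : mulg_closed conj_preim.
Proof. by move=> x z xS zS; rewrite unfold_in conjMg gpredM. Qed.
Fact conj_preim1 : 1 \in conj_preim.
Proof. by rewrite unfold_in conj1g gpred1. Qed.
Fact conj_preimV : invg_closed conj_preim.
Proof. by move=> x xS; rewrite unfold_in conjVg gpredVr. Qed.
HB.instance Definition _ := isMulClosed.Build G conj_preim conj_preimM.
HB.instance Definition _ := isMul1Closed.Build G conj_preim conj_preim1.
HB.instance Definition _ := isInvClosed.Build G conj_preim conj_preimV.
End ConjPreim.

Section Commutator.
Variables (G : groupType) (S T : normalClosed G).

(** MathComp has [[~ x, y] = x^-1 * y^-1 * x * y]; as [S] and [T] are closed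
    under inverse, the generated subgroup does not depend on this convention. *)
Definition comm_pred : {pred G} :=
  gen_pred (fun z => `[< exists x y, [/\ x \in S, y \in T & z = [~ x, y]] >]).

HB.instance Definition _ := GroupClosed.copy comm_pred (gen_pred _).

Lemma comm_predR x y : x \in S -> y \in T -> [~ x, y] \in comm_pred.
Proof.
move=> xS yT; rewrite unfold_in; apply/asboolP => U; apply.
by rewrite unfold_in; apply/asboolP; exists x, y.
Qed.

Fact comm_predJ x y : x \in comm_pred -> x ^ y \in comm_pred.
Proof.
move=> /asboolP /(_ (conj_preim comm_pred y)); apply.
move=> z /asboolP[s [t [sS tT ->]]].
by rewrite unfold_in /conj_preim conjRg comm_predR ?gpredJn.
Qed.
HB.instance Definition _ := isConjClosed.Build G comm_pred comm_predJ.
End Commutator.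

Section SubgroupType.
Variables (G : groupType) (S : groupClosed G).

Definition subgroup : Type := {x : G | x \in S}.

HB.instance Definition _ := SubChoice.on subgroup.

Fact subgroup_closed : group_closed (S : {pred G}).
Proof. by split; [apply: gpred1 | apply: gpredF]. Qed.
HB.instance Definition _ :=
  SubChoice_isSubGroup.Build G (fun x => x \in S) subgroup subgroup_closed.
End SubgroupType.

Section Quotient.
Variables (G : groupType) (N : normalClosed G).

Definition coset_rel : rel G := fun x y => x^-1 * y \in N.

Fact coset_rel_equiv : equiv_class_of coset_rel.
Proof.
split=> [x|x y|y x z]; first by rewrite /coset_rel mulVg gpred1.
- by rewrite /coset_rel -[X in X = _](gpredV N) invgM invgK.
- rewrite /coset_rel => xy yz.
  have -> : x^-1 * z = x^-1 * y * (y^-1 * z) by rewrite !mulgA mulgK.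
  exact: gpredM.
Qed.
Canonical coset_equiv := EquivRelPack coset_rel_equiv.

Definition quotient_group := {eq_quot coset_equiv}%qT.
HB.instance Definition _ := Choice.on quotient_group.
HB.instance Definition _ := EqQuotient.on quotient_group.

Definition qclass (x : G) : quotient_group := (\pi x)%qT.

Definition qrepr (u : quotient_group) : G := generic_quotient.repr u.

Lemma qclassP x y : reflect (qclass x = qclass y) (x^-1 * y \in N).
Proof. exact: (@eqmodP _ coset_equiv x y). Qed.

Lemma qclass_reprK (u : quotient_group) : qclass (qrepr u) = u.
Proof. exact: reprK. Qed.

Lemma qclassW (P : quotient_group -> Prop) :
  (forall x, P (qclass x)) -> forall u, P u.
Proof. by move=> Px u; rewrite -(qclass_reprK u). Qed.

Definition qmul (u v : quotient_group) := qclass (qrepr u * qrepr v).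
Definition qinv (u : quotient_group) := qclass (qrepr u)^-1.

Fact qmulE x y : qmul (qclass x) (qclass y) = qclass (x * y).
Proof.
apply/qclassP.
have /qclassP xN := qclass_reprK (qclass x).
have /qclassP yN := qclass_reprK (qclass y).
set a := qrepr (qclass x) in xN *; set b := qrepr (qclass y) in yN *.
have -> : (a * b)^-1 * (x * y) = (a^-1 * x) ^ b * (b^-1 * y).
  by rewrite conjgE invgM !mulgA mulgK.
by rewrite gpredM ?gpredJn.
Qed.
Fact qinvE x : qinv (qclass x) = qclass x^-1.
Proof.
apply/qclassP; have /qclassP xN := qclass_reprK (qclass x).
set a := qrepr (qclass x) in xN *.
have -> : a^-1^-1 * x^-1 = ((a^-1 * x)^-1) ^ a^-1.
  by rewrite conjgE invgM !invgK !mulgA mulgK.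
by rewrite gpredJn ?gpredVr.
Qed.
Fact qmulA : associative qmul.
Proof.
elim/qclassW=> x; elim/qclassW=> y; elim/qclassW=> z.
by rewrite !qmulE mulgA.
Qed.
Fact qmul1 : left_id (qclass 1) qmul.
Proof. by elim/qclassW=> x; rewrite qmulE mul1g. Qed.
Fact qmulx1 : right_id (qclass 1) qmul.
Proof. by elim/qclassW=> x; rewrite qmulE mulg1. Qed.
Fact qmulV : left_inverse (qclass 1) qinv qmul.
Proof. by elim/qclassW=> x; rewrite qinvE qmulE mulVg. Qed.
Fact qmulxV : right_inverse (qclass 1) qinv qmul.
Proof. by elim/qclassW=> x; rewrite qinvE qmulE mulgV. Qed.
HB.instance Definition _ :=
  isGroup.Build quotient_group qmulA qmul1 qmulx1 qmulV qmulxV.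

Fact qclassM : {morph qclass : x y / x * y}.
Proof. by move=> x y; rewrite -[LHS]qmulE. Qed.
Fact qclass1 : qclass 1 = 1. Proof. by []. Qed.
HB.instance Definition _ :=
  isUMagmaMorphism.Build _ _ qclass (qclass1, qclassM).

Lemma qclass_eq1 x : (qclass x == 1) = (x \in N).
Proof.
rewrite -(gpredV N); apply/eqP/idP => [/esym x1|xN].
  by apply: (gpredVr (s := N)); move/qclassP: x1; rewrite invg1 mul1g.
by apply/qclassP; rewrite mulg1.
Qed.

Section QuotientImage.
Variable S : groupClosed G.

(** The image of [S] in [G / N]; it stands for [S / N] when [N] is contained
    in [S]. *)
Definition qimage : {pred quotient_group} :=
  fun u => `[< exists2 x, x \in S & u = qclass x >].

Fact qimageM : mulg_closed qimage.
Proof.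
move=> u v; rewrite !unfold_in => /asboolP[x xS ->] /asboolP[y yS ->].
by apply/asboolP; exists (x * y); rewrite ?gpredM ?gmulfM.
Qed.
Fact qimage1 : 1 \in qimage.
Proof. by rewrite unfold_in; apply/asboolP; exists 1; rewrite ?gpred1. Qed.
Fact qimageV : invg_closed qimage.
Proof.
move=> u; rewrite !unfold_in => /asboolP[x xS ->].
by apply/asboolP; exists x^-1; rewrite ?gpredVr ?gmulfV.
Qed.
HB.instance Definition _ := isMulClosed.Build quotient_group qimage qimageM.
HB.instance Definition _ := isMul1Closed.Build quotient_group qimage qimage1.
HB.instance Definition _ := isInvClosed.Build quotient_group qimage qimageV.
End QuotientImage.
End Quotient.

Section FreeGroup.
Variable T : choiceType.

(** The letter [(x, true)] stands for the generator of index [x] and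
    [(x, false)] for its inverse; elements are the reduced words. *)
Definition letter : Type := T * bool.
HB.instance Definition _ := Choice.on letter.

Definition letterV (a : letter) : letter := (a.1, ~~ a.2).

Definition reduced : pred (seq letter) := sorted (fun a b => b != letterV a).

Definition free_group : Type := {w : seq letter | reduced w}.
HB.instance Definition _ := SubChoice.on free_group.

Definition cons_letter (a : letter) (w : seq letter) :=
  if w is b :: w' then if b == letterV a then w' else a :: w else [:: a].

Definition reduce (w : seq letter) := foldr cons_letter [::] w.

Fact letterVK : involutive letterV.
Proof. by case=> x b; rewrite /letterV /= negbK. Qed.

Fact reduced_cons a w : reduced w -> reduced (cons_letter a w).
Proof.
case: w => //= b w bw; case: ifP => [_|/negbT ab]; first exact: path_sorted bw.
by rewrite /reduced /= ab.
Qed.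

Fact reduced_foldr u v : reduced v -> reduced (foldr cons_letter v u).
Proof. by move=> rv; elim: u => //= a u; apply: reduced_cons. Qed.

Fact reduceP w : reduced (reduce w).
Proof. exact: reduced_foldr. Qed.

Fact reduce_id w : reduced w -> reduce w = w.
Proof.
elim: w => //= a w IHw aw; rewrite (IHw (path_sorted aw)).
by case: w aw {IHw} => //= b w /andP[/negbTE->].
Qed.

Fact cons_letterK a w :
  reduced w -> cons_letter (letterV a) (cons_letter a w) = w.
Proof.
case: w => [|b w] /=; first by rewrite letterVK eqxx.
case: eqVneq => [->|_] bw /=; last by rewrite letterVK eqxx.
by case: w bw => //= c w /andP[/negbTE->].
Qed.

Fact foldr_reduce u v : reduced v ->
  foldr cons_letter v (reduce u) = foldr cons_letter v u.
Proof.
move=> rv; elim: u => //= a u IHu; rewrite -[in RHS]IHu.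
case: (reduce u) => //= b w; case: eqP => //= ->.
by rewrite -[X in cons_letter X]letterVK cons_letterK ?reduced_foldr.
Qed.

Fact reduce_cat u v : reduce (u ++ v) = foldr cons_letter (reduce v) u.
Proof. exact: foldr_cat. Qed.

Definition word_inv (w : seq letter) := rev (map letterV w).

Fact reduced_inv w : reduced w -> reduced (word_inv w).
Proof.
rewrite /reduced /word_inv rev_sorted sorted_map; apply: sub_sorted => a b /=.
by apply: contra => /eqP ->; rewrite !letterVK.
Qed.

Definition free_mul (u v : free_group) : free_group :=
  exist _ (reduce (val u ++ val v)) (reduceP _).
Definition free_one : free_group := exist _ [::] isT.
Definition free_inv (u : free_group) : free_group :=
  exist _ (word_inv (val u)) (reduced_inv (valP u)).

Fact free_mulA : associative free_mul.
Proof.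
have mulE u v : val (free_mul u v) = reduce (val u ++ val v) by [].
move=> u v w; apply: val_inj; rewrite !mulE.
rewrite reduce_cat (reduce_id (reduceP _)) -reduce_cat catA.
by rewrite [RHS]reduce_cat foldr_reduce ?reduceP // reduce_cat.
Qed.
Fact free_mul1 : left_id free_one free_mul.
Proof. by move=> u; apply: val_inj; rewrite /= reduce_id ?(valP u). Qed.
Fact free_mulx1 : right_id free_one free_mul.
Proof. by move=> u; apply: val_inj; rewrite /= cats0 reduce_id ?(valP u). Qed.
Fact free_mulV : left_inverse free_one free_inv free_mul.
Proof.
case=> u ru; apply: val_inj => /= {ru}.
elim: u => //= a u IHu; rewrite /word_inv /= rev_cons cat_rcons.
rewrite !reduce_cat /= cons_letterK ?reduceP // -reduce_cat.
exact: IHu.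
Qed.
Fact free_mulxV : right_inverse free_one free_inv free_mul.
Proof.
move=> u; rewrite -[LHS]free_mul1 -[X in free_mul X](free_mulV (free_inv u)).
by rewrite -free_mulA [X in free_mul _ X]free_mulA free_mulV free_mul1 free_mulV.
Qed.
HB.instance Definition _ :=
  isGroup.Build free_group free_mulA free_mul1 free_mulx1 free_mulV free_mulxV.

Definition free_gen (x : T) : free_group := exist _ [:: (x, true)] isT.

Section Lift.
Variables (H : groupType) (f : T -> H).

Definition letter_eval (a : letter) : H := if a.2 then f a.1 else (f a.1)^-1.

Definition free_lift (u : free_group) : H := \prod_(a <- val u) letter_eval a.

Fact letter_evalV a : letter_eval (letterV a) = (letter_eval a)^-1.
Proof. by case: a => x [] //=; rewrite /letter_eval /= invgK. Qed.

Fact eval_foldr u v : \prod_(a <- foldr cons_letter v u) letter_eval a =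
  (\prod_(a <- u) letter_eval a) * \prod_(a <- v) letter_eval a.
Proof.
elim: u => [|a u IHu] /=; first by rewrite big_nil mul1g.
rewrite big_cons -mulgA -IHu.
case: (foldr _ _ _) => [|b w] /=; first by rewrite big_seq1 big_nil mulg1.
case: eqP => [->|_]; last by rewrite big_cons.
by rewrite big_cons letter_evalV mulVKg.
Qed.

Fact free_liftM : {morph free_lift : u v / u * v}.
Proof.
by move=> u v; rewrite /free_lift /= eval_foldr big_cat big_nil /= mulg1.
Qed.
Fact free_lift1 : free_lift 1 = 1.
Proof. exact: big_nil. Qed.
HB.instance Definition _ :=
  isUMagmaMorphism.Build _ _ free_lift (free_lift1, free_liftM).

Lemma free_lift_gen x : free_lift (free_gen x) = f x.
Proof. exact: big_seq1. Qed.
End Lift.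
End FreeGroup.

Section AssociatedGroup.
Variables (gT : finGroupType) (X : {set gT}).

Definition points : Type := {x : gT | x \in X}.
HB.instance Definition _ := SubFinite.on points.

Local Notation FX := (free_group points).
Local Notation g_ := (@free_gen points).

(** [z] is the element [x |> y = x y x^-1] of [X]. *)
Definition rack_relators : {pred FX} := fun r =>
  `[< exists x y z : points, val z = val x * val y * (val x)^-1 /\
        r = g_ x * g_ y * (g_ x)^-1 * (g_ z)^-1 >].

Definition associated_group : groupType :=
  quotient_group (normal_closure rack_relators).
End AssociatedGroup.

Section SchurMultiplier.
Variables (gT : finGroupType) (X : {set gT}).

Local Notation FX := (free_group (points X)).

Definition proj : FX -> gT := free_lift val.
HB.instance Definition _ := UMagmaMorphism.on proj.

Local Notation RX := (ker_pred proj).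
Local Notation "[ 'FX' , 'FX' ]" :=
  (comm_pred (@full_pred FX) (@full_pred FX)).
Local Notation "[ 'FX' , 'RX' ]" := (comm_pred (@full_pred FX) RX).

(** The group [F_X / [F_X, R_X]]. *)
Definition schur_cover : groupType :=
  quotient_group [FX, RX].

Local Notation cls :=
  (@qclass FX [FX, RX]).

Definition cover_proj (u : schur_cover) : gT := proj (qrepr u).

Lemma comm_ker (r : FX) :
  r \in [FX, RX] -> proj r = 1.
Proof.
move=> /asboolP /(_ RX) rK; apply/eqP/rK => z.
move=> /asboolP[x [y [_ /eqP yK ->]]].
by apply/eqP; rewrite gmulfR yK commg1.
Qed.

Lemma cover_projE (w : FX) : cover_proj (cls w) = proj w.
Proof.
have /qclassP/comm_ker := qclass_reprK (cls w).
by rewrite gmulfM gmulfV => /mulg1_eq; rewrite invgK.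
Qed.

Fact cover_projM : {morph cover_proj : u v / u * v}.
Proof.
elim/qclassW=> u; elim/qclassW=> v.
by rewrite -gmulfM !cover_projE gmulfM.
Qed.
Fact cover_proj1 : cover_proj 1 = 1.
Proof. by rewrite -(@gmulf1 _ _ cls) cover_projE gmulf1. Qed.
HB.instance Definition _ := isUMagmaMorphism.Build
  schur_cover gT cover_proj (cover_proj1, cover_projM).
Fact cover_projV u : cover_proj u^-1 = (cover_proj u)^-1.
Proof. exact: gmulfV. Qed.

(** The quotient [(R_X :&: [F_X, F_X]) / [F_X, R_X]], as the subgroup of
    [F_X / [F_X, R_X]] made of the classes of the elements of the numerator. *)
Definition schur_multiplier : groupType :=
  subgroup (@qimage FX [FX, RX] (cap_pred RX [FX, FX])).

Lemma cover_ker_central u v : cover_proj u = 1 -> commute u v.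
Proof.
elim/qclassW: u => u; elim/qclassW: v => v; rewrite cover_projE => u1.
apply/esym/commgP; rewrite -gmulfR qclass_eq1.
by apply: comm_predR => //; apply/eqP.
Qed.

Lemma cover_proj_comm h h' v : cover_proj h = cover_proj h' ->
  h * v * h^-1 = h' * v * h'^-1.
Proof.
move=> hh'; have zC : commute (h^-1 * h') v.
  by apply: cover_ker_central; rewrite cover_projM cover_projV hh' mulVg.
have -> : h' = h * (h^-1 * h') by rewrite mulVKg.
rewrite -[h * (h^-1 * h') * v]mulgA zC mulgA invgM mulgA.
by rewrite -[h * v * _ * _]mulgA mulgV mulg1.
Qed.

Definition cover_comm (h y : schur_cover) := h * y * h^-1 * y^-1.

Lemma cover_comm_eq h h' y y' : cover_proj h = cover_proj h' ->
  cover_proj y = cover_proj y' -> cover_comm h y = cover_comm h' y'.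
Proof.
rewrite /cover_comm => hh' yy'; rewrite (cover_proj_comm _ hh').
by have /(congr1 (mul h')) := cover_proj_comm h'^-1 yy'; rewrite !mulgA.
Qed.

(** The default values in [preimage] and [mu] are not used when [X] generates
    [G] and [g] is in ['C_G[x]]: see [muE], where [h] and [y] are arbitrary
    preimages of [g] and [x]. *)
Definition preimage (g : gT) : schur_cover :=
  if pselect (exists h, cover_proj h == g) is left e then xchoose e else 1.

Definition mu (x : points X) (g : gT) : schur_multiplier :=
  insubd 1 (cover_comm (preimage g) (cls (free_gen x))).

Lemma cover_proj_gen x : cover_proj (cls (free_gen x)) = val x.
Proof. by rewrite cover_projE /proj free_lift_gen. Qed.

Lemma preimageK h : cover_proj (preimage (cover_proj h)) = cover_proj h.
Proof.
rewrite /preimage; case: pselect => [e|[]]; last by exists h.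
exact/eqP/(xchooseP e).
Qed.

Lemma muE (x : points X) (g : gT) (h y : schur_cover) :
  g \in 'C[val x] -> cover_proj h = g -> cover_proj y = val x ->
  val (mu x g) = h * y * h^-1 * y^-1.
Proof.
move=> gC hg yx; rewrite /mu insubdK.
  by apply: cover_comm_eq; rewrite ?cover_proj_gen // -hg preimageK.
rewrite (@cover_comm_eq _ h _ y) ?cover_proj_gen // -?hg ?preimageK //.
rewrite /cover_comm; move: h y hg yx.
elim/qclassW=> h; elim/qclassW=> y; rewrite !cover_projE => hg yx.
apply/asboolP; exists (h * y * h^-1 * y^-1); last first.
  by rewrite !(gmulfM, gmulfV).
apply/andP; split.
  have projE : proj (h * y * h^-1 * y^-1) =
    proj h * proj y * (proj h)^-1 * (proj y)^-1 by rewrite !(gmulfM, gmulfV).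
  by apply/eqP; rewrite [LHS]projE hg yx (cent1P gC) mulgK mulgV.
have -> : h * y * h^-1 * y^-1 = [~ h^-1, y^-1].
  by rewrite commgEl conjgE !invgK !mulgA.
exact: comm_predR.
Qed.

Fact mu_out (x : points X) (g : gT) :
  ~ (exists h, cover_proj h == g) -> mu x g = 1.
Proof.
move=> gN; rewrite /mu /preimage; case: pselect => // _.
rewrite /cover_comm mul1g invg1 mulg1 mulgV.
by apply: val_inj; rewrite insubdK // gpred1.
Qed.

(** [mu x] is a morphism on the elements of ['C[x]] that are in the image of
    [cover_proj], i.e., in the subgroup generated by [X]. *)
Lemma muM (x : points X) (g g' : schur_cover) :
  cover_proj g \in 'C[val x] -> cover_proj g' \in 'C[val x] ->
  mu x (cover_proj g * cover_proj g') =
  mu x (cover_proj g) * mu x (cover_proj g').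
Proof.
move=> gC g'C; have xE := cover_proj_gen x; set y := cls _ in xE.
apply: val_inj; rewrite valM (muE gC erefl xE) (muE g'C erefl xE).
rewrite (muE (groupM gC g'C) (cover_projM _ _) xE).
set z := g' * y * g'^-1 * y^-1.
have zC v : commute z v.
  apply: cover_ker_central; rewrite !(cover_projM, cover_projV) xE.
  by rewrite (cent1P g'C) mulgK mulgV.
have -> : g * g' * y * (g * g')^-1 * y^-1 = g * (z * (y * g^-1 * y^-1)).
  by rewrite /z invgM !mulgA mulgVK.
by rewrite zC !mulgA.
Qed.

Fact mu1 (x : points X) : mu x 1 = 1.
Proof.
apply: val_inj; rewrite (muE (group1 _) cover_proj1 (cover_proj_gen x)).
by rewrite mul1g invg1 mulg1 mulgV val1.
Qed.

Fact schur_multiplierC (u v : schur_multiplier) : commute u v.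
Proof.
apply: val_inj; rewrite !valM; apply: cover_ker_central.
case: u => u /= /asboolP[w /andP[/eqP wK _] ->].
by rewrite cover_projE.
Qed.

Section MuImage.
Variables (G : {group gT}) (x : points X).

Definition mu_image : {pred schur_multiplier} :=
  fun m => [exists g in 'C_G[val x], m == mu x g].

Fact mu_imageP m : reflect (exists2 g, g \in 'C_G[val x] & m = mu x g)
  (m \in mu_image).
Proof.
apply: (iffP exists_inP) => -[g gC]; first by move/eqP; exists g.
by move=> ->; exists g.
Qed.

Fact mu_image1 : 1 \in mu_image.
Proof. by apply/mu_imageP; exists 1; rewrite ?group1 ?mu1. Qed.

Fact mu_imageM : mulg_closed mu_image.
Proof.
move=> u v /mu_imageP[g gC ->] /mu_imageP[h hC ->]; apply/mu_imageP.
have [[g' /eqP gE]|/mu_out->] := pselect (exists w, cover_proj w == g); last first.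
  by exists h; rewrite ?mul1g.
have [[h' /eqP hE]|/mu_out->] := pselect (exists w, cover_proj w == h); last first.
  by exists g; rewrite ?mulg1.
exists (g * h); first exact: groupM.
by move: gC hC; rewrite -gE -hE => /setIP[_ gC] /setIP[_ hC]; rewrite muM.
Qed.

Fact mu_imageV : invg_closed mu_image.
Proof.
move=> u /mu_imageP[g gC ->]; apply/mu_imageP.
have [[g' /eqP gE]|/mu_out->] := pselect (exists w, cover_proj w == g); last first.
  by exists 1; rewrite ?group1 ?mu1 ?invg1.
exists g^-1; first by rewrite groupV.
move: gC; rewrite -gE => /setIP[_ gC].
apply: mulg1_eq; rewrite -cover_projV -muM ?cover_projV ?groupV //.
by rewrite mulgV mu1.
Qed.

Fact mu_imageJ u v : u \in mu_image -> u ^ v \in mu_image.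
Proof. by rewrite conjgE (schur_multiplierC u v) mulKg. Qed.

HB.instance Definition _ := isMulClosed.Build _ mu_image mu_imageM.
HB.instance Definition _ := isMul1Closed.Build _ mu_image mu_image1.
HB.instance Definition _ := isInvClosed.Build _ mu_image mu_imageV.
HB.instance Definition _ := isConjClosed.Build _ mu_image mu_imageJ.

Definition relative_schur_multiplier : groupType := quotient_group mu_image.
End MuImage.
End SchurMultiplier.

Definition group_iso (G H : groupType) : Prop :=
  exists f : {multiplicative G -> H}, bijective f.

Definition trivial_group (G : groupType) : Prop := forall x : G, x = 1.

(** The additive group of integers, written multiplicatively. *)
Definition Zgroup : Type := int.
HB.instance Definition _ := Choice.on Zgroup.
HB.instance Definition _ := isGroup.Build Zgroup
  (@GRing.addrA int) (@GRing.add0r int) (@GRing.addr0 int)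
  (@GRing.addNr int) (@GRing.addrN int).

Section SpecialLinear.
Variable F : finFieldType.

Definition SL2 : {set {'GL_2[F]}} := [set g | (\det (GLval g) == 1)%R].

Fact SL2_group_set : group_set SL2.
Proof.
apply/group_setP; split=> [|g h]; first by rewrite inE GL_1E det1.
by rewrite !inE GL_MxE det_mulmx => /eqP-> /eqP->; rewrite GRing.mulr1.
Qed.
Canonical SL2_group := group SL2_group_set.

Definition PSL2 : {set coset_of 'Z(SL2)} := SL2 / 'Z(SL2).
Canonical PSL2_group := [group of PSL2].
End SpecialLinear.

Definition involutions (gT : finGroupType) (G : {set gT}) : {set gT} :=
  [set x in G | #[x] == 2].

(* Main.v *)
Require Import Defs.
From HB Require Import structures.
From mathcomp Require Import all_boot all_order all_algebra all_fingroup center.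
From mathcomp Require Import cyclic pgroup abelian finfield ring boolp.

Set Implicit Arguments.
Unset Strict Implicit.
Unset Printing Implicit Defensive.

Import GroupScope GRing.Theory.

(** Everything rests on one property of SL(2,q), for q > 4 and q <> 9: it is
    perfect and all its central extensions split. In the form used here
    ([SL2_central_lift]), a homomorphism from SL(2,q) to a group [Q] lifts along
    every homomorphism [p : E -> Q] with central kernel whose image contains
    that of SL(2,q); as SL(2,q) is perfect, the lift is unique
    ([perfect_hom_eq]). The kernel of [p] may be infinite, so that
    Sylow subgroups of [E] give nothing; the proof is Steinberg's, by generators
    and relations.

    To lift, one first shows that all the lifts of upper unitriangular matrices
    commute: their commutators give an alternating biadditive map from F x F to
    a central subgroup, invariant under multiplication by squares, and such a
    map is trivial ([square_invariant_alternating]); this is where q = 4 and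
    q = 9 have to be excluded. Taking commutators with a diagonal matrix then
    selects an additive lift [x t] of each root element, equivariant under the
    diagonal group. Lifts [y t], [w t], [h a] of the lower unitriangular, the
    monomial and the diagonal matrices are built from it by the usual formulas,
    and the only relation that is not formal is [h (a * b) = h a * h b]. It
    holds when [a] or [b] is a square because the preimage of the cyclic
    diagonal group is abelian. On nonsquares the defect is a constant, and the
    identity [h u * h v = h (u * v)] for [u + v = 1] makes the constant trivial,
    since some nonsquare [u] has [1 - u] nonsquare as well. The Bruhat normal
    form finally defines a homomorphism on SL(2,q).

    A nontrivial class [X] generates PSL(2,q) ([class_gen]), as a normal
    subgroup of SL(2,q) with a noncentral element is everything
    ([SL2_normal_full]). So the lifting property applies to the two central
    extensions of PSL(2,q) at hand, As(X) and F_X / [F_X, R_X].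

    What decides between the cases is whether the lifts to SL(2,q) of two
    commuting elements of PSL(2,q), one of them in [X], always commute. The
    commutator of the lifts is 1 or -1, and it is -1 for some pair exactly when
    q is odd and [X] consists of elements whose lifts have trace 0, which are
    the involutions and form a single class ([lifts_commute],
    [involution_anticommuting], [involution_class]).

    For As(X) ([associated_group_iso]): if [X] has a section into a perfect
    central cover [L] of PSL(2,q) that is equivariant for the conjugation by
    [L], and if [L] maps to As(X), then As(X) is the product of the image of [L]
    with the infinite cyclic group generated by a central element. When lifts
    commute, [X] has such a section into SL(2,q); otherwise -1 has trivial image
    in As(X) and [L = PSL(2,q)] is used.

    For the multiplier, M(G) is the image of the centre {1, -1} of SL(2,q) in
    F_X / [F_X, R_X], on which that centre acts faithfully ([psi_inj]), and the
    image of [mu] is the set of the commutators of lifts considered above. *)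

(** * Squares in a finite field *)

Section Fields.
Local Open Scope ring_scope.
Variable F : finFieldType.

Lemma card_finField_expn :
  exists p n, [/\ prime p, p \in [pchar F] & #|F| = (p ^ n)%N].
Proof.
have [p p_pr charFp] := finPcharP F; exists p.
have /abelem_pgroup/p_natP[n] := fin_ring_pchar_abelem charFp.
by rewrite cardsT => ->; exists n.
Qed.

Lemma odd_card_finField : odd #|F| = (2 != 0 :> F).
Proof.
have [p [n [p_pr charFp cardF]]] := card_finField_expn.
have n_gt0: (0 < n)%N by rewrite lt0n; have := finNzRing_gt1 F; rewrite cardF;
  case: (n).
rewrite cardF oddX -(dvdn_pcharf charFp) gtn_eqF //= dvdn_prime2 //.
by have [->|/[dup] + ->] := even_prime p_pr; case: eqP => // ->.
Qed.

Definition is_square : {pred F} := fun t => [exists a, t == a ^+ 2].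

Lemma is_squareP t : reflect (exists a, t = a ^+ 2) (t \in is_square).
Proof. by apply: (iffP existsP) => -[a ta]; exists a; apply/eqP. Qed.

(** Squaring is two-to-one away from 0. *)
Lemma card_squares : 2 != 0 :> F -> (2 * #|is_square| = #|F|.+1)%N.
Proof.
move=> nz2.
have -> : #|F| = (\sum_(s in is_square) #|[set a | a ^+ 2 == s]|)%N.
  rewrite -sum1_card (partition_big (fun a => a ^+ 2) (mem is_square)) /=.
    by apply: eq_bigr => s _; rewrite -sum1_card; apply: eq_bigl => a;
      rewrite inE.
  by move=> a _; apply/is_squareP; exists a.
have sq0 : 0 \in is_square by apply/is_squareP; exists 0; rewrite expr0n.
rewrite (bigD1 0) //= (eq_bigr (fun=> 2%N)); last first.
  move=> _ /andP[/is_squareP[a ->]]; rewrite sqrf_eq0 => nz_a.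
  have -> : [set b | b ^+ 2 == a ^+ 2] = [set a; - a].
    by apply/setP => b; rewrite !inE eqf_sqr.
  by rewrite cards2 -subr_eq0 opprK -mulr2n -mulr_natl mulf_neq0.
have -> : [set a : F | a ^+ 2 == 0] = [set 0].
  by apply/setP => b; rewrite !inE sqrf_eq0.
rewrite cards1 sum_nat_const (cardD1 0) sq0 mulnDr add1n.
congr (_.+2); rewrite mulnC; congr (_ * _)%N.
by apply: eq_card => x; rewrite !inE andbC.
Qed.

(** More than half of the elements are squares, so the squares meet their image
    under [t |-> s - t]. *)
Lemma sum_two_squares (s : F) : 2 != 0 :> F -> exists a b, s = a ^+ 2 + b ^+ 2.
Proof.
move=> nz2; have cS := card_squares nz2.
have [t] : exists t, (t \in is_square) && (s - t \in is_square).
  apply/existsP/contraT => /existsPn none.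
  have: (#|is_square| <= #|[predC is_square]|)%N.
    rewrite -(card_image (f := fun t => s - t));
      last by move=> x y /addrI/oppr_inj.
    apply/subset_leq_card/subsetP => _ /imageP[t tS ->]; rewrite inE /=.
    by have := none t; rewrite tS.
  by move: cS; rewrite -(cardC is_square) mul2n -addnn -addnS => /addnI->;
    rewrite ltnn.
case/andP=> /is_squareP[a ta] /is_squareP[b tb]; exists a, b.
by rewrite -ta -tb addrC subrK.
Qed.

(** In characteristic 2, squaring is injective. *)
Lemma nonsquare_char t : t \notin is_square -> 2 != 0 :> F.
Proof.
apply: contraNneq => F2; apply/is_squareP.
have sq_inj : injective (fun a : F => a ^+ 2).
  move=> a b /= /eqP; rewrite eqf_sqr => /orP[/eqP-> // | /eqP->].
  by rewrite -[LHS]addr0 -(mul0r b) -F2 mulr_natl mulr2n addKr.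
by exists (invF sq_inj t); rewrite (f_invF sq_inj).
Qed.

(** There is one more nonsquare than there are squares other than 0 and 1, so
    [t |-> 1 - t] cannot map all the nonsquares to squares. *)
Lemma nonsquare_sum1 : 2 != 0 :> F ->
  exists2 t : F, t \notin is_square & 1 - t \notin is_square.
Proof.
move=> nz2; have cS := card_squares nz2.
have [t] : exists t, (t \notin is_square) && (1 - t \notin is_square).
  apply/existsP/contraT => /existsPn none.
  have sq0 : 0 \in is_square by apply/is_squareP; exists 0; rewrite expr0n.
  have sq1 : 1 \in is_square by apply/is_squareP; exists 1; rewrite expr1n.
  have: (#|[predC is_square]| <= #|[predD1 [predD1 is_square & 0%R] & 1%R]|)%N.
    rewrite -(card_image (f := fun t => 1 - t));
      last by move=> x y /addrI/oppr_inj.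
    apply/subset_leq_card/subsetP => _ /imageP[t tS ->].
    have := none t; rewrite !inE in tS *; rewrite tS /= negbK => ->.
    rewrite andbT -subr_eq0 addrAC subrr sub0r oppr_eq0 (subr_eq0 1 t).
    by apply/andP; split; [apply: contraNneq tS => ->|apply: contraNneq tS => <-].
  move: cS; rewrite -(cardC is_square) mul2n -addnn -addnS => /addnI.
  rewrite (cardD1 0) sq0 (cardD1 1 [predD1 _ & _]) /= !inE oner_eq0 sq1.
  by case=> <-; rewrite ltnn.
by case/andP; exists t.
Qed.

Lemma finField_mulgen : exists2 v : F, v != 0 & forall t, t != 0 ->
  exists k, t = v ^+ k.
Proof.
have /cyclicP[u uP] : cyclic [set: {unit F}] by apply: field_unit_group_cyclic.
exists (FinRing.uval u); first by rewrite -unitfE (valP u).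
move=> t; rewrite -unitfE => Ut.
have /cycleP[k tk]: FinRing.unit F Ut \in <[u]>%g by rewrite -uP inE.
by exists k; rewrite -FinRing.val_unitX -tk.
Qed.

Lemma nonsquare_div t u :
  t \notin is_square -> u \notin is_square -> exists2 a, a != 0 & t = u * a ^+ 2.
Proof.
have sq0 : 0 \in is_square by apply/is_squareP; exists 0; rewrite expr0n.
have [v _ vP] := finField_mulgen => nt nu.
have nzt: t != 0 by apply: contraNneq nt => ->.
have nzu: u != 0 by apply: contraNneq nu => ->.
have [k tk] := vP t nzt; have [l ul] := vP u nzu.
have oddk : odd k.
  apply: contraR nt => ek; apply/is_squareP; exists (v ^+ k./2).
  by rewrite -exprM muln2 even_halfK.
have oddl : odd l.
  apply: contraR nu => el; apply/is_squareP; exists (v ^+ l./2).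
  by rewrite -exprM muln2 even_halfK.
have tu : t * u = (v ^+ (k + l)./2) ^+ 2.
  by rewrite -exprM muln2 even_halfK ?exprD ?oddD ?oddk ?oddl -?tk -?ul.
exists (v ^+ (k + l)./2 / u).
  by rewrite mulf_neq0 ?invr_eq0 // -sqrf_eq0 -tu mulf_neq0.
by rewrite expr_div_n -tu; field.
Qed.

Lemma poly_nonroot (P : {poly F}) : P != 0 -> (size P <= #|F|)%N ->
  exists a, P.[a] != 0.
Proof.
move=> nzP szP; apply/existsP; apply: contraLR szP => /existsPn P0;
  rewrite -ltnNge.
rewrite cardE; apply: max_poly_roots => //; last exact: enum_uniq.
by apply/allP => a _; rewrite rootE -[_ == _]negbK P0.
Qed.

Lemma exists_expn_neq1 n : (0 < n)%N -> (n.+1 < #|F|)%N ->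
  exists2 b : F, b != 0 & b ^+ n != 1.
Proof.
move=> n_gt0 ltn; have [||b] := @poly_nonroot ('X * 'X^n - 'X).
- rewrite -exprS -size_poly_gt0 size_polyDl size_polyXn // size_polyN size_polyX.
  by rewrite ltnS.
- by rewrite -exprS size_polyDl size_polyXn // size_polyN size_polyX ltnS.
rewrite !hornerE => nzP; exists b.
  by apply: contraNneq nzP => ->; rewrite mul0r subrr.
by apply: contraNneq nzP => ->; rewrite mulr1 subrr.
Qed.

(** A pair as needed in [square_invariant_alternating]. In characteristic 2,
    [b = a + 1] always gives [a ^+ 2 + b ^+ 2 = 1]; otherwise the unit circle is
    parametrized by rational functions of [t]. In both cases the values to
    avoid are the roots of a polynomial of degree less than the order of the
    field. *)
Lemma two_squares_sum1 : (2 == 0 :> F) && (4 < #|F|)%N || (13 < #|F|)%N ->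
  exists a b : F, [/\ a != 0, b != 0, a ^+ 2 + b ^+ 2 = 1 & a ^+ 2 * b ^+ 2 != 1].
Proof.
have szM (p q : {poly F}) m n : (size p <= m.+1 -> size q <= n.+1 ->
    size (p * q)%R <= (m + n).+1)%N.
  move=> szp szq; apply: leq_trans (size_polyMleq _ _) _.
  by have := leq_add szp szq; rewrite addSn addnS; case: (size p + size q)%N.
have szC c : (size (c%:P : {poly F}) <= 1)%N by apply: size_polyC_leq1.
have szX : (size ('X : {poly F}) <= 2)%N by rewrite size_polyX.
have szX2 : (size ('X * 'X : {poly F})%R <= 3)%N by apply: (szM _ _ 1 1).
have szD (p q : {poly F}) m : (size p <= m -> size q <= m ->
    size (p + q)%R <= m)%N.
  by move=> szp szq; apply: leq_trans (size_polyD _ _) _; rewrite geq_max szp.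
have nzP (p q : {poly F}) : p.[0] != 0 -> q != 0 -> q * p != 0.
  move=> nzp nzq; rewrite mulf_neq0 //.
  by apply: contraNneq nzp => ->; rewrite horner0.
have nzX : 'X != 0 :> {poly F} by rewrite polyX_eq0.
have [F2 q4|nz2 /= q13] := eqVneq 2 (0 : F).
  have add1 (x : F) : x + x = 0 by rewrite -mulr2n -mulr_natl F2 mul0r.
  have {}q4: (4 < #|F|)%N by case/orP: q4 => //; apply: leq_trans.
  pose P : {poly F} := 'X * ('X + 1%:P) * ('X * 'X + 'X + 1%:P).
  have [||a] := @poly_nonroot P.
  - by rewrite /P !nzP ?hornerE /= ?addr0 ?mulr0 ?add0r ?oner_neq0.
  - apply: leq_trans (szM _ _ 2 2 _ _) q4; first apply: (szM _ _ 1 1) => //.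
      by rewrite szD ?szX ?(leq_trans (szC _)).
    by rewrite !szD ?(leq_trans szX) ?(leq_trans (szC _)).
  rewrite !hornerE /= !mulf_eq0 !negb_or -andbA => /and3P[nza nza1 nzQ].
  exists a, (a + 1); split=> //.
    by rewrite sqrrD mulr1 expr1n addrA addrA -mulr_natl F2 mul0r addr0 add1
      add0r.
  rewrite -exprMn sqrf_eq1.
  have neg1 : -1 = 1 :> F by rewrite -[LHS]add0r -(add1 1) addrK.
  rewrite neg1 orbb; apply: contraNneq nzQ => Q1; apply/eqP.
  by rewrite -[RHS](add1 1) -[X in _ = X + _]Q1; ring.
(* [Q] is the denominator of the parametrization, and [4 * R * R] divided by
   [Q ^+ 4] is the value of [a ^+ 2 * b ^+ 2]. *)
pose Q : {poly F} := 1%:P + 'X * 'X.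
pose R : {poly F} := 'X * (1%:P - 'X * 'X).
pose P : {poly F} := 'X * (1%:P - 'X * 'X) * Q * (Q * Q * (Q * Q) - 4%:P * (R *
  R)).
have szN (p : {poly F}) m : (size p <= m -> size (- p)%R <= m)%N by rewrite
  size_polyN.
have sz1X : (size (1%:P - 'X * 'X : {poly F})%R <= 3)%N.
  by apply: szD; [apply: leq_trans (szC _) _|apply: szN].
have szQ : (size Q <= 3)%N by apply: szD => //; apply: leq_trans (szC _) _.
have szR : (size R <= 4)%N by apply: (szM _ _ 1 2).
have [||t] := @poly_nonroot P.
- by rewrite /P !nzP //= /R /Q !hornerE /= ?(mulr0, mul0r, subr0, mulr1)
    oner_neq0.
- apply: leq_trans (szM _ _ 5 8 _ _) q13.
    by apply: (szM _ _ 3 2) => //; apply: (szM _ _ 1 2).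
  apply: szD; first by apply: (szM _ _ 4 4); apply: (szM _ _ 2 2).
  by apply: szN; apply: leq_trans (szM _ _ 0 6 _ _) _ => //; apply: (szM _ _ 3 3).
rewrite /P /Q /R !hornerE /= !mulf_eq0 !negb_or -!andbA.
move=> /and4P[nzt nz1 nzQt nzQR].
exists ((1 - t * t) / (1 + t * t)), (2 * t / (1 + t * t)).
split; [by rewrite mulf_neq0 ?invr_eq0| | by field|].
  by rewrite !mulf_neq0 ?invr_eq0.
rewrite -subr_eq0; apply: contraNneq nzQR => H; apply/eqP.
by rewrite -[RHS](mulr0 (- (1 + t * t) ^+ 4)) -H; field.
Qed.

Lemma pcharf_card_nat p : p \in [pchar F] -> #|F| = p ->
  forall x : F, exists k, x = k%:R.
Proof.
move=> charFp cardF x; pose f (i : 'I_p) : F := (i : nat)%:R.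
have f_inj : injective f.
  suff H (i j : 'I_p) : (i <= j)%N -> f i = f j -> i = j.
    move=> i j eq_ij; case/orP: (leq_total i j) => le_ij; first exact: H.
    by apply/esym/H.
  move=> le_ij /eqP; rewrite eq_sym -subr_eq0 -natrB //.
  rewrite -(dvdn_pcharf charFp) => /dvdn_leq dv; apply/val_inj/eqP.
  rewrite eqn_leq le_ij /= -subn_eq0; apply: contraTT (ltn_ord j).
  by rewrite -lt0n => /dv pj; rewrite -leqNgt; apply: leq_trans pj (leq_subr _ _).
have le_card : (#|F| <= #|'I_p|)%N by rewrite card_ord cardF.
by have /codomP[i ->] := inj_card_onto f_inj le_card x; exists i.
Qed.

(** Over a prime field [f] is determined by [f 1 1]. Otherwise take
    [a ^+ 2 + b ^+ 2 = 1]: writing [t] as [a ^+ 2 * t + b ^+ 2 * t] and moving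
    the squares to the second argument gives [f t u = f t (k * u)] with
    [k = a ^- 2 + b ^- 2], hence [f t] vanishes on multiples of [k - 1], which
    is not 0 if [a ^+ 2 * b ^+ 2] is not 1. Over the field with 4 elements the
    determinant of the F_2-linear plane is a counterexample, and similarly for
    9. *)
Lemma square_invariant_alternating (G : groupType) (f : F -> F -> G) :
    (4 < #|F|)%N -> #|F| != 9 ->
    (forall t t' u, f (t + t') u = (f t u * f t' u)%g) ->
    (forall t u u', f t (u + u') = (f t u * f t u')%g) ->
    (forall t, f t t = 1%g) ->
    (forall a t u : F, a != 0 -> f (a ^+ 2 * t) (a ^+ 2 * u) = f t u) ->
  forall t u, f t u = 1%g.
Proof.
move=> q4 q9 fDl fDr ftt fsq.
have [p [[|[|n]] [p_pr charFp cardF]]] := card_finField_expn.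
- by rewrite cardF in q4.
- have natP := pcharf_card_nat charFp cardF.
  have f0l u : f 0 u = 1%g by apply: (@mulIg _ (f 0 u)); rewrite -fDl addr0 mul1g.
  have f0r t : f t 0 = 1%g by apply: (@mulIg _ (f t 0)); rewrite -fDr addr0 mul1g.
  move=> t u; have [k ->] := natP t; have [l ->] := natP u.
  elim: k => [|k IHk]; first exact: f0l.
  rewrite -[k.+1%:R]natr1 fDl IHk mul1g; elim: l {IHk} => [|l IHl];
    first exact: f0r.
  by rewrite -[l.+1%:R]natr1 fDr IHl mul1g ftt.
have [|a [b [nza nzb ab1 nab]] t u] := two_squares_sum1.
  case: (altP (2 =P 0 :> F)) => [_|] /=; first by rewrite q4.
  (* An odd prime power with exponent at least 2, other than 9, is at least 25. *)
  rewrite -(dvdn_pcharf charFp) dvdn_prime2 // cardF => np2.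
  have p3: (2 < p)%N by rewrite ltn_neqAle eq_sym np2 prime_gt1.
  have [p5|] := leqP 5 p; last rewrite ltnS leq_eqVlt => /orP[/eqP p4|].
  - apply: (@leq_trans (5 ^ 2)) => //.
    by apply: (@leq_trans (p ^ 2)); rewrite ?leq_exp2r ?leq_exp2l // prime_gt1.
  - by rewrite p4 in p_pr.
  rewrite ltnS => p_le3; have {p3 p_le3} p3 : p = 3 by apply/eqP;
    rewrite eqn_leq p_le3.
  move: q9; rewrite cardF p3; case: (n) => [|m] // _.
  by apply: (@leq_trans (3 ^ 3)) => //; rewrite leq_exp2l.
set k := (a ^+ 2)^-1 + (b ^+ 2)^-1.
have fk u' : f t u' = f t (k * u').
  rewrite -[t in LHS]mul1r -ab1 mulrDl fDl mulrDl fDr.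
  by congr (_ * _)%g; [rewrite -(fsq a t) // mulVKf ?expf_neq0|
     rewrite -(fsq b t) // mulVKf ?expf_neq0].
have kE : k * (a ^+ 2 * b ^+ 2) = 1 by rewrite -ab1 /k; field; apply/andP.
have nzk : k - 1 != 0.
  rewrite subr_eq0; apply: contraNneq nab => k1.
  by rewrite -[X in X == _]mul1r -[X in X * _]k1 kE.
apply: (@mulgI _ (f t (u / (k - 1)))).
rewrite -fDr mulg1 [RHS]fk; by congr f; field.
Qed.
End Fields.

(** * Matrices of determinant one *)

(** [field], with the side conditions discharged by the hypotheses that some
    elements are not 0. *)
Ltac field_nz :=
  field; rewrite ?oppr_eq0 ?oner_neq0 /=;
  repeat (apply/andP; split); by [].

Section Matrices.
Local Open Scope ring_scope.
Variable F : fieldType.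

(** Explicit entries turn identities between products of matrices into field
    identities. *)
Definition mx2 (a b c d : F) : 'M[F]_2 :=
  \matrix_(i, j) if i == 0 then if j == 0 then a else b
                 else if j == 0 then c else d.

Lemma mx2_eta (A : 'M[F]_2) : A = mx2 (A 0 0) (A 0 1) (A 1 0) (A 1 1).
Proof.
apply/matrixP => i j; rewrite mxE.
have ord2P (k : 'I_2) : {k = 0} + {k = 1}.
  by case: k => [[|[|//]] lt_k]; [left | right]; apply/val_inj.
by case: (ord2P i) => ->; case: (ord2P j) => ->.
Qed.

Lemma mul_mx2 a b c d a' b' c' d' : mx2 a b c d *m mx2 a' b' c' d' =
  mx2 (a * a' + b * c') (a * b' + b * d') (c * a' + d * c') (c * b' + d * d').
Proof.
apply/matrixP => i j; rewrite !mxE !big_ord_recl big_ord0 addr0 !mxE /=.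
by case: (i == 0); case: (j == 0).
Qed.

Lemma det_mx2 a b c d : \det (mx2 a b c d) = a * d - b * c.
Proof.
rewrite (expand_det_row _ 0) !big_ord_recl big_ord0 addr0 /cofactor !det_mx11.
by rewrite !mxE /= expr0 mul1r expr1 mulN1r mulrN.
Qed.

Lemma mx2_1 : mx2 1 0 0 1 = 1%:M.
Proof. by apply/matrixP => i j; rewrite !mxE; case:
  i j => [[|[|//]] ?] [[|[|//]] ?]. Qed.

Definition upper t := mx2 1 t 0 1.
Definition lower t := mx2 1 0 t 1.
Definition torus a := mx2 a 0 0 a^-1.
Definition weyl t := mx2 0 t (- t^-1) 0.

Lemma det_upper t : \det (upper t) = 1. Proof. by rewrite det_mx2; ring. Qed.
Lemma det_lower t : \det (lower t) = 1. Proof. by rewrite det_mx2; ring. Qed.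
Lemma det_torus a : a != 0 -> \det (torus a) = 1.
Proof. by move=> nza; rewrite det_mx2; field. Qed.
Lemma det_weyl t : t != 0 -> \det (weyl t) = 1.
Proof. by move=> nzt; rewrite det_mx2; field. Qed.

(** The Bruhat decomposition. *)
Lemma SL2_weyl_ind (P : 'M[F]_2 -> Prop) :
    (forall t, P (upper t)) -> (forall t, t != 0 -> P (weyl t)) ->
    (forall A B, P A -> P B -> P (A *m B)) ->
  forall A, \det A = 1 -> P A.
Proof.
move=> PU PW PM A; rewrite (mx2_eta A) det_mx2.
move: (A 0 0) (A 0 1) (A 1 0) (A 1 1) => a b c d detA.
have [c0|nzc] := eqVneq c 0.
  have nza : a != 0.
    by apply: contra_eq_neq detA => ->; rewrite c0 mul0r mulr0 subrr eq_sym
      oner_neq0.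
  have dE : d = a^-1 by rewrite -[d](mulKf nza) -[a * d](subrK (b * c)) detA c0
    mulr0 addr0 mulr1.
  have -> : mx2 a b c d = upper (b / d) *m (weyl a *m weyl (-1)).
    by rewrite !mul_mx2 c0 dE; congr mx2; field_nz.
  have nzN1 : - 1 != 0 :> F by rewrite oppr_eq0 oner_neq0.
  exact: PM (PU _) (PM _ _ (PW _ nza) (PW _ nzN1)).
have bE : b = (a * d - 1) / c by rewrite -detA opprB addrC subrK mulfK.
have -> : mx2 a b c d = upper (a / c) *m (weyl (- c^-1) *m upper (d / c)).
  by rewrite !mul_mx2 bE; congr mx2; field_nz.
have nzV : - c^-1 != 0 by rewrite oppr_eq0 invr_eq0.
exact: PM (PU _) (PM _ _ (PW _ nzV) (PU _)).
Qed.

Lemma SL2_elementary_ind (P : 'M[F]_2 -> Prop) :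
    (forall t, P (upper t)) -> (forall t, P (lower t)) ->
    (forall A B, P A -> P B -> P (A *m B)) ->
  forall A, \det A = 1 -> P A.
Proof.
move=> PU PV PM; apply: SL2_weyl_ind => // t nzt.
have -> : weyl t = upper t *m (lower (- t^-1) *m upper t).
  by rewrite !mul_mx2; congr mx2; field.
exact: PM (PU _) (PM _ _ (PV _) (PU _)).
Qed.
End Matrices.

Section FiniteMatrices.
Local Open Scope ring_scope.
Variable F : finFieldType.
Implicit Types A B C : 'M[F]_2.

Lemma oppmx_char2 A : ~~ odd #|F| -> - A = A.
Proof.
rewrite odd_card_finField negbK => /eqP F2; apply/matrixP => i j; rewrite !mxE.
by rewrite -[LHS]addr0 -(mul0r (A i j)) -F2 mulr_natl mulr2n addKr.
Qed.

Lemma cayley_hamilton2 A : \det A = 1 -> A *m A = \tr A *: A - 1%:M.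
Proof.
rewrite (mx2_eta A) det_mx2.
move: (A 0 0) (A 0 1) (A 1 0) (A 1 1) => a b c d detA.
rewrite mul_mx2 -mx2_1 /mxtrace !big_ord_recl big_ord0 !mxE /= addr0.
apply/matrixP => i j; rewrite !mxE.
by case: (i == 0); case: (j == 0); rewrite -?detA; ring.
Qed.

Lemma centralizing_scalar A :
    A *m upper 1 = upper 1 *m A -> A *m lower 1 = lower 1 *m A ->
  A = (A 0 0)%:M.
Proof.
rewrite (mx2_eta A); move: (A 0 0) (A 0 1) (A 1 0) (A 1 1) => a b c d.
rewrite !mul_mx2 => /matrixP eU /matrixP eV.
move: (eU 0 0) (eU 0 1) (eV 0 0) (eV 1 0).
rewrite !mxE /= !(mul0r, mulr0, mul1r, mulr1, add0r, addr0).
move=> /eqP; rewrite -subr_eq0 opprD addNKr oppr_eq0 => /eqP c0.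
move=> /eqP; rewrite addrC (inj_eq (addrI _)) => /eqP ad.
move=> /eqP; rewrite -subr_eq0 addrK => /eqP b0 _.
apply/matrixP => i j; rewrite !mxE c0 b0 -ad.
by case: i j => [[|[|//]] ?] [[|[|//]] ?].
Qed.

Lemma conj_lower_neq0 A : (forall a, A != a%:M) ->
  exists2 B, \det B = 1 & exists C, A *m B = B *m C /\ C 1 0 != 0.
Proof.
rewrite (mx2_eta A); move: (A 0 0) (A 0 1) (A 1 0) (A 1 1) => a b c d nsc.
have [c0|nzc] := eqVneq c 0; last first.
  by exists 1%:M; rewrite ?det1 //; exists (mx2 a b c d);
    rewrite mulmx1 mul1mx mxE.
have [b0|nzb] := eqVneq b 0; last first.
  exists (weyl 1); first by rewrite det_weyl ?oner_neq0.
  exists (mx2 d (- c) (- b) a); split; last by rewrite mxE oppr_eq0.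
  by rewrite !mul_mx2 invr1; congr mx2; ring.
exists (lower 1); first exact: det_lower.
exists (mx2 a 0 (d - a) d); rewrite !mul_mx2 b0 c0 mxE /=; split.
  by congr mx2; ring.
apply: contra (nsc a) => /eqP/subr0_eq->; rewrite b0 c0; apply/eqP/matrixP => i j.
by rewrite !mxE; case: i j => [[|[|//]] ?] [[|[|//]] ?].
Qed.

(** For a vector [v] that is not an eigenvector, [A] has this form in the basis
    made of [v] and a multiple of its image; the multiple is needed to change
    the basis by a matrix of determinant 1. *)
Lemma noncentral_conj A : \det A = 1 -> (forall a, A != a%:M) ->
  exists2 B, \det B = 1 & exists2 s, s != 0 &
    A *m B = B *m mx2 0 (- s^-1) s (\tr A).
Proof.
move=> detA /conj_lower_neq0[B detB [C [AB nzC]]].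
have uB : B \in unitmx by rewrite unitmxE detB unitr1.
have CE : C = invmx B *m (A *m B) by rewrite AB mulKmx.
have trC : \tr C = \tr A by rewrite CE mxtrace_mulC mulmxK.
have detC : \det C = 1 by rewrite CE !det_mulmx detA detB det_inv detB invr1
  !mulr1.
exists (B *m upper (C 0 0 / C 1 0)); first by rewrite det_mulmx detB det_upper
  mulr1.
exists (C 1 0) => //; rewrite mulmxA AB -!mulmxA; congr (_ *m _).
move: detC trC nzC; rewrite (mx2_eta C) det_mx2 !mxE /=.
move: (C 0 0) (C 0 1) (C 1 0) (C 1 1) => a b c d detC.
rewrite {1}/mxtrace !big_ord_recl big_ord0 !mxE /= addr0 => <- nzc.
rewrite !mul_mx2 (_ : - c^-1 = b - a * d / c); first by congr mx2; field.
by apply: (mulIf nzc); rewrite mulNr mulVf // -detC; field.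
Qed.

(** By [noncentral_conj] it is enough to conjugate [weyl t] to [weyl 1]. The
    matrices that do this in GL(2,q) have a determinant of the form
    [t * (c ^+ 2 + d ^+ 2)], and a sum of two squares takes all values. *)
Lemma trace0_conj A : 2 != 0 :> F -> \det A = 1 -> \tr A = 0 ->
  exists2 B, \det B = 1 & A *m B = B *m weyl 1.
Proof.
move=> nz2 detA trA.
have nsc a : A != a%:M.
  apply: contra_eq_neq detA => AE; move: trA; rewrite AE mxtrace_scalar => /eqP.
  rewrite -mulr_natl mulf_eq0 (negPf nz2) /= => /eqP->.
  by rewrite det_scalar expr0n eq_sym oner_neq0.
have [B detB [s nzs]] := noncentral_conj detA nsc; rewrite trA => AB.
have [c [d cd]] := sum_two_squares (- s) nz2.
have nzV : - s^-1 != 0 by rewrite oppr_eq0 invr_eq0.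
pose g := mx2 (- s^-1 * d) (s^-1 * c) c d.
exists (B *m g).
  by rewrite det_mulmx detB mul1r det_mx2 -[LHS]opprK -[RHS](divff nzs) -[X in
    X / s]opprK cd; field.
rewrite mulmxA AB -!mulmxA; congr (_ *m _); rewrite !mul_mx2.
by congr mx2; rewrite ?invr1; field.
Qed.

(** It suffices to treat [weyl 1], which anticommutes with the symmetric
    matrices of trace 0; one of them has determinant 1 because -1 is a sum of
    two squares. *)
Lemma anticommuting A : 2 != 0 :> F -> \det A = 1 -> \tr A = 0 ->
  exists2 B, \det B = 1 & A *m B = - (B *m A).
Proof.
move=> nz2 detA /(trace0_conj nz2 detA)[C detC AC].
have uC : C \in unitmx by rewrite unitmxE detC unitr1.
have [a [b ab]] := sum_two_squares (-1 : F) nz2.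
pose g := mx2 a b b (- a).
have Wg : weyl 1 *m g = - (g *m weyl 1).
  rewrite !mul_mx2; apply/matrixP => i j; rewrite !mxE invr1.
  by case: (i == 0); case: (j == 0); ring.
exists (C *m g *m invmx C).
  rewrite !det_mulmx detC det_inv detC invr1 mulr1 mul1r det_mx2.
  by rewrite -[RHS]opprK ab; ring.
have AE : A = C *m weyl 1 *m invmx C by rewrite -AC mulmxK.
rewrite !AE -!mulmxA !(mulmxA (invmx C)) !mulVmx // !mul1mx.
by rewrite !(mulmxA (weyl 1)) Wg (mulmxA g) mulNmx mulmxN.
Qed.

End FiniteMatrices.

Section NormalSubsets.
(* [N] stands for a normal subgroup of SL(2,q). *)
Local Open Scope ring_scope.
Variables (F : finFieldType) (N : 'M[F]_2 -> Prop).
Hypothesis q4 : (4 < #|F|)%N.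
Hypothesis N_det : forall A, N A -> \det A = 1.
Hypothesis N_mul : forall A B, N A -> N B -> N (A *m B).
Hypothesis N_inv : forall A B, N A -> A *m B = 1%:M -> N B.
Hypothesis N_conj : forall A B C, \det B = 1 -> A *m B = B *m C -> N A -> N C.

Let full_of_lower : (forall t, N (lower t)) -> forall A, \det A = 1 -> N A.
Proof.
move=> NV; apply: SL2_elementary_ind => // t.
apply: (N_conj (B := weyl 1) _ _ (NV (- t))); first by rewrite det_weyl
  ?oner_neq0.
by rewrite !mul_mx2 invr1; congr mx2; ring.
Qed.

(** The commutator of [torus a] with the normal form of [A] in
    [noncentral_conj]. *)
Let lower_triangular A a : \det A = 1 -> (forall r, A != r%:M) -> N A -> a != 0 ->
  exists2 s, s != 0 & N (mx2 (a ^+ 2) 0 (\tr A * s * (1 - a ^+ 2)) (a ^- 2)).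
Proof.
move=> detA nsc NA nza.
have [B detB [s nzs AB]] := noncentral_conj detA nsc.
have {detB AB}NM := N_conj detB AB NA; move: (\tr A) NM => tau NM.
have NMi : N (mx2 tau s^-1 (- s) 0).
  by apply: (N_inv NM); rewrite mul_mx2 -mx2_1; congr mx2; field.
have NMa : N (mx2 0 (- a ^+ 2 / s) (s / a ^+ 2) tau).
  have nzV : a^-1 != 0 by rewrite invr_eq0.
  apply: (N_conj (det_torus nzV) _ NM).
  by rewrite !mul_mx2; congr mx2; field_nz.
exists (s * a ^- 2); first by rewrite mulf_neq0 // invr_eq0 expf_neq0.
have := N_mul NMa NMi; rewrite mul_mx2; congr (N (mx2 _ _ _ _)); by field_nz.
Qed.

(** The commutators of a triangular matrix with the lower unitriangular ones;
    [1 - a ^+ 4] is the resulting dilation factor. *)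
Let lower_of_quartic a : a != 0 -> a ^+ 4 != 1 ->
  forall r, N (mx2 (a ^+ 2) 0 r (a ^- 2)) -> forall t, N (lower t).
Proof.
move=> nza a4 r NK t; pose v := t / (1 - a ^+ 4).
have nzk : 1 - a ^+ 4 != 0 by rewrite subr_eq0 eq_sym.
have NKi : N (mx2 (a ^- 2) 0 (- r) (a ^+ 2)).
  by apply: (N_inv NK); rewrite mul_mx2 -mx2_1; congr mx2; field.
have NKv : N (mx2 (a ^+ 2) 0 (r + v * (a ^- 2 - a ^+ 2)) (a ^- 2)).
  apply: (N_conj (det_lower v) _ NK).
  by rewrite !mul_mx2; congr mx2; ring.
have := N_mul NKi NKv; rewrite mul_mx2; congr (N (mx2 _ _ _ _)); rewrite /v;
  by field_nz.
Qed.

(** In the field with 5 elements all [a ^+ 4] are 1 for [a] nonzero, but if [a]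
    has order 4 the square of the triangular matrix is unitriangular, and it is
    not 1 when [A] has nonzero trace. *)
Let full_of_card5 A : #|F| = 5 -> (forall r, A != r%:M) -> N A -> \tr A != 0 ->
  forall t, N (lower t).
Proof.
move=> cardF nsc NA nztr.
have charF : 5 \in [pchar F] by apply: (@card_finPcharP F 5 1).
have natF := pcharf_card_nat charF cardF.
have nz2 : 2 != 0 :> F by rewrite -(dvdn_pcharf charF).
have [b nzb nb2] : exists2 b : F, b != 0 & b ^+ 2 != 1 by apply:
  exists_expn_neq1; rewrite ?cardF.
have b2 : b ^+ 2 = -1.
  apply/eqP; rewrite -addr_eq0; have := expf_card b.
  rewrite cardF => /eqP; rewrite -subr_eq0.
  have -> : b ^+ 5 - b = b * ((b ^+ 2 - 1) * (b ^+ 2 + 1)) by ring.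
  by rewrite !mulf_eq0 (negPf nzb) subr_eq0 (negPf nb2).
have [s nzs NK] := lower_triangular (N_det NA) nsc NA nzb.
move: NK; rewrite b2; set m := _ * _ * _ => NK.
have nzm : - (2 * m) != 0.
  by rewrite oppr_eq0 !mulf_neq0 // opprK.
have NV : N (lower (- (2 * m))).
  have := N_mul NK NK; rewrite mul_mx2 invrN invr1.
  congr (N (mx2 _ _ _ _)); ring.
have N1 : N 1%:M.
  have NVi : N (lower (2 * m)).
    by apply: (N_inv NV); rewrite mul_mx2 -mx2_1; congr mx2; ring.
  by have := N_mul NV NVi; rewrite mul_mx2 -mx2_1; congr (N (mx2 _ _ _ _)); ring.
move=> t; have [k tk] := natF (t / - (2 * m)).
have -> : t = k%:R * - (2 * m) by rewrite -tk divfK.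
elim: k {tk} => [|k IHk].
  by rewrite mul0r /lower mx2_1.
have := N_mul IHk NV; rewrite mul_mx2; congr (N (mx2 _ _ _ _));
  rewrite -?natr1; ring.
Qed.

(** A normal subgroup of SL(2,q) is central or everything. Over the field with 5
    elements, an element of trace 0 is first replaced by its commutator with an
    upper unitriangular matrix, chosen to have trace 3. *)
Lemma SL2_normal_full A : N A -> (forall r, A != r%:M) ->
  forall B, \det B = 1 -> N B.
Proof.
move=> NA nsc; apply: full_of_lower; have detA := N_det NA.
have [q5|] := ltnP 5 #|F|.
  have [a nza a4] : exists2 a : F, a != 0 & a ^+ 4 != 1 by apply:
    exists_expn_neq1.
  have [s nzs NK] := lower_triangular detA nsc NA nza.
  exact: lower_of_quartic NK.
move=> q5; have {q5} cardF : #|F| = 5 by apply/eqP; rewrite eqn_leq q5.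
have [trA|nztr] := eqVneq (\tr A) 0; last exact: full_of_card5 NA nztr.
have charF : 5 \in [pchar F] by apply: (@card_finPcharP F 5 1).
have [B detB [s nzs AB]] := noncentral_conj detA nsc.
have {detB AB}NM := N_conj detB AB NA; rewrite trA in NM.
have NMi : N (mx2 0 s^-1 (- s) 0).
  by apply: (N_inv NM); rewrite mul_mx2 -mx2_1; congr mx2; field.
have NMu : N (mx2 1 (- 2 / s) s (- 1)).
  apply: (N_conj (det_upper (- s^-1)) _ NM).
  by rewrite !mul_mx2; congr mx2; field.
have := N_mul NMu NMi; rewrite mul_mx2 => NC.
apply: full_of_card5 NC _ => //.
  move=> r; apply/eqP => /matrixP/(_ 0 1); rewrite !mxE /= => /eqP.
  by rewrite mulr0 addr0 mul1r invr_eq0 (negPf nzs).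
rewrite /mxtrace !big_ord_recl big_ord0 !mxE /= addr0.
have -> : 1 * 0 + -2 / s * - s + (s * s^-1 + -1 * 0) = 3 :> F by field.
by rewrite -(dvdn_pcharf charF).
Qed.
End NormalSubsets.

(** * Homomorphisms and central extensions *)

Section Generic.
Implicit Types G H E L : groupType.

Lemma commMgJ G (x y z : G) : [~ x * y, z] = [~ x, z] ^ y * [~ y, z].
Proof. by rewrite !commgEr conjgM mulgA -conjMg mulgK. Qed.

Lemma commgMJ G (x y z : G) : [~ x, y * z] = [~ x, z] * [~ x, y] ^ z.
Proof. by rewrite !commgEl conjgM -mulgA -conjMg mulVKg. Qed.

Lemma comm_mul_central G (x y z t : G) :
    (forall u, commute z u) -> (forall u, commute t u) ->
  [~ x * z, y * t] = [~ x, y].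
Proof.
move=> zC tC; have fixC (c u : G) : (forall v, commute c v) -> u ^ c = u.
  by move=> cC; rewrite conjgE -cC mulKg.
rewrite commMgJ fixC // (_ : [~ z, _] = 1) ?mulg1; last exact/eqP/commgP.
by rewrite commgMJ fixC // (_ : [~ x, t] = 1) ?mul1g //;
  apply/eqP/commgP/commute_sym.
Qed.

Lemma hom_of_morph G H (f : G -> H) : {morph f : x y / x * y} ->
  exists g : UMagmaMorphism.type G H, forall x, g x = f x.
Proof.
move=> fM; have f1 : f 1 = 1 by apply: (mulgI (f 1)); rewrite -fM !mulg1.
pose g : UMagmaMorphism.type G H :=
  HB.pack f (isUMagmaMorphism.Build G H f (f1, fM)).
by exists g.
Qed.

(** The subgroup generated by [A] is defined by quantification over bundled
    subgroups; here is the corresponding induction on unbundled predicates. *)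
Lemma gen_pred_ind G (A : {pred G}) (P : G -> Prop) :
    P 1 -> (forall x y, P x -> P y -> P (x * y)) -> (forall x, P x -> P x^-1) ->
    {in A, forall x, P x} ->
  {in gen_pred A, forall x, P x}.
Proof.
move=> P1 PM PV PA x /asboolP xA.
pose S : {pred G} := fun x => `[< P x >].
have S1 : 1 \in S by apply/asboolP.
have SM : mulg_closed S by move=> y z /asboolP Py /asboolP Pz; apply/asboolP/PM.
have SV : invg_closed S by move=> y /asboolP Py; apply/asboolP/PV.
pose S' : groupClosed G := HB.pack S (isMulClosed.Build G S SM)
  (isMul1Closed.Build G S S1) (isInvClosed.Build G S SV).
by apply/asboolP/(xA S') => y yA; apply/asboolP/PA.
Qed.

Lemma comm_pred_ind G (S T : normalClosed G) (P : G -> Prop) :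
    P 1 -> (forall x y, P x -> P y -> P (x * y)) -> (forall x, P x -> P x^-1) ->
    (forall x y, x \in S -> y \in T -> P [~ x, y]) ->
  {in comm_pred S T, forall x, P x}.
Proof.
move=> P1 PM PV PR; apply: gen_pred_ind => // _ /asboolP[x [y [xS yT ->]]].
exact: PR.
Qed.

Definition perfect G := forall g : G, g \in comm_pred (@full_pred G)
  (@full_pred G).

Lemma perfect_ind G (P : G -> Prop) : perfect G ->
    P 1 -> (forall x y, P x -> P y -> P (x * y)) -> (forall x, P x -> P x^-1) ->
    (forall x y, P [~ x, y]) ->
  forall x, P x.
Proof. by move=> perfG P1 PM PV PR x; apply: comm_pred_ind (perfG x). Qed.

(** Two homomorphisms that differ by central elements agree on commutators. *)
Lemma perfect_hom_eq L E (f g : UMagmaMorphism.type L E) : perfect L ->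
    (forall l e, commute ((f l)^-1 * g l) e) ->
  forall l, f l = g l.
Proof.
move=> perfL fgC; apply: perfect_ind => // [|x y fx fy|x fx|x y].
- by rewrite !gmulf1.
- by rewrite !gmulfM fx fy.
- by rewrite !gmulfV fx.
by rewrite !gmulfR -[g x](mulVKg (f x)) -[g y](mulVKg (f y)) comm_mul_central.
Qed.

Lemma perfect_image (L H : groupType) (f : UMagmaMorphism.type L H) :
  perfect L -> (forall h, exists l, f l = h) -> perfect H.
Proof.
move=> perfL f_onto h; have [l <-] := f_onto h.
apply: (perfect_ind (P := fun l => f l \in comm_pred _ _)) perfL _ _ _ _ l.
- by rewrite gmulf1 gpred1.
- by move=> x y fx fy; rewrite gmulfM gpredM.
- by move=> x fx; rewrite gmulfV gpredVr.
by move=> x y; rewrite gmulfR comm_predR.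
Qed.

Lemma quotient_lift G H (N : normalClosed G) (f : UMagmaMorphism.type G H) :
    (forall x, x \in N -> f x = 1) ->
  exists g : UMagmaMorphism.type (Defs.quotient_group N) H,
    forall x, g (qclass N x) = f x.
Proof.
move=> fN; pose g (u : Defs.quotient_group N) := f (qrepr u).
have gE x : g (qclass N x) = f x.
  have /qclassP/fN := qclass_reprK (qclass N x).
  by rewrite gmulfM gmulfV => /mulg1_eq; rewrite invgK.
have [|g' g'E] := hom_of_morph (f := g).
  by elim/qclassW=> x; elim/qclassW=> y; rewrite -gmulfM !gE gmulfM.
by exists g' => x; rewrite g'E gE.
Qed.

(** Prepending a letter to a reduced word that stays reduced is multiplication
    by a generator or its inverse. *)
Lemma free_ind (T : choiceType) (P : free_group T -> Prop) :
    P 1 -> (forall x u, P u -> P (free_gen x * u)) ->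
    (forall x u, P u -> P ((free_gen x)^-1 * u)) ->
  forall u, P u.
Proof.
move=> P1 PM PV [w rw].
have letterE a : val (letter_eval (@free_gen T) a) = [:: a] by case: a => x [].
elim: w rw => [|a w IHw] raw.
  by have -> : exist _ [::] raw = 1 :> free_group T by apply: val_inj.
have rw := path_sorted raw.
have -> : exist _ (a :: w) raw =
    letter_eval (@free_gen T) a * exist _ w rw :> free_group T.
  by apply: val_inj; rewrite /= letterE /= reduce_id //; move: raw;
    case: (w) => //= b v /andP[/negbTE->].
by case: a {raw letterE} => x []; [apply: PM | apply: PV].
Qed.

Lemma two_element_group H (h : H) : h != 1 -> (forall x, x = 1 \/ x = h) ->
  group_iso H 'Z_2.
Proof.
move=> nt_h H2; pose f (x : H) : 'Z_2 := if x == 1 then 1 else (1%R : 'Z_2).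
have hh : h * h = 1.
  case: (H2 (h * h)) => // /eqP; rewrite -{3}[h]mulg1 (inj_eq (@mulgI _ h)).
  by rewrite (negPf nt_h).
have fM : {morph f : x y / x * y}.
  move=> x y; rewrite /f; case: (H2 x) => ->; case: (H2 y) => ->;
    by rewrite ?hh ?mulg1 ?mul1g ?eqxx ?(negPf nt_h) ?mulg1 ?mul1g //;
      apply/val_inj.
have [g gE] := hom_of_morph fM; exists g.
exists (fun i : 'Z_2 => if i == 1 then 1 else h) => [x|i]; rewrite gE /f.
  by case: (H2 x) => ->; rewrite ?eqxx ?(negPf nt_h).
by case: i => [[|[|//]] lti] /=; rewrite ?eqxx ?(negPf nt_h); apply: val_inj.
Qed.
End Generic.

Section Central.
Variables (E Q : groupType) (p : UMagmaMorphism.type E Q).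
Hypothesis pC : forall u v, p u = 1 -> commute u v.

Lemma central_ker (e e' : E) : p e = p e' ->
  exists2 z, (forall v, commute z v) & e' = e * z.
Proof.
move=> pee'; exists (e^-1 * e'); last by rewrite mulVKg.
by move=> v; apply: pC; rewrite gmulfM gmulfV pee' mulVg.
Qed.

(** Commutators in a central extension depend only on the images of their
    arguments, which is what makes arbitrary lifts usable below. *)
Lemma central_comm (e e' x x' : E) : p e = p e' -> p x = p x' ->
  [~ e, x] = [~ e', x'].
Proof.
by case/central_ker=> z zC -> /central_ker[t tC ->]; rewrite comm_mul_central.
Qed.
End Central.

(** * Lifting SL(2,q) through central extensions *)

Section Lifting.
(* [l] chooses an arbitrary lift of each matrix of determinant 1. *)
Variables (F : finFieldType) (E Q : groupType) (p : UMagmaMorphism.type E Q).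
Variables (rho : 'M[F]_2 -> Q) (l : 'M[F]_2 -> E).
Hypothesis q4 : 4 < #|F|.
Hypothesis q9 : #|F| != 9.
Hypothesis pC : forall u v, p u = 1 -> commute u v.
Hypothesis rhoM : forall A B,
  (\det A = 1)%R -> (\det B = 1)%R -> rho (A *m B)%R = rho A * rho B.
Hypothesis pl : forall A, (\det A = 1)%R -> p (l A) = rho A.

Local Notation U t := (@upper F t%R).
Local Notation V t := (@lower F t%R).
Local Notation D a := (@torus F a%R).
Local Notation W t := (@weyl F t%R).

Let rho1 : rho 1%:M%R = 1.
Proof. by apply: (mulgI (rho 1%:M%R)); rewrite -rhoM ?det1 // mul1mx mulg1. Qed.

(** To locate the image of a conjugate it is enough to solve [A B = B C], which
    avoids inverse matrices. *)
Let overJ x e A B C : (\det A = 1)%R -> (\det B = 1)%R -> (\det C = 1)%R ->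
  (A *m B = B *m C)%R -> p x = rho A -> p e = rho B -> p (x ^ e) = rho C.
Proof.
by move=> dA dB dC AB xA eB; rewrite gmulfJ xA eB conjgE -rhoM // AB rhoM ?mulKg.
Qed.

Let rho_upperD s t : rho (U (s + t)) = rho (U s) * rho (U t).
Proof.
by rewrite -rhoM ?det_upper // mul_mx2; congr (rho (mx2 _ _ _ _)); ring.
Qed.

Let rho_upper_commute t u : commute (rho (U t)) (rho (U u)).
Proof. by rewrite /commute -!rho_upperD addrC. Qed.

Let rho_upperN t : rho (U (- t)) = (rho (U t))^-1.
Proof.
apply/esym/mulg1_eq; rewrite -rho_upperD subrr -rho1; congr rho; exact: mx2_1.
Qed.

Let pM u v : p (u * v) = p u * p v. Proof. exact: gmulfM. Qed.
Let pV u : p u^-1 = (p u)^-1. Proof. exact: gmulfV. Qed.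

Let central_fix x y : p x = 1 -> x ^ y = x.
Proof. by move/pC => xC; rewrite conjgE xC mulKg. Qed.

Let upper_torus a t : a != 0%R -> (U t *m D a = D a *m U (t / a ^+ 2))%R.
Proof.
by move=> nza; rewrite !mul_mx2; congr mx2; field; rewrite ?expf_neq0.
Qed.

(** The commutator pairing of two lifts is central, biadditive and alternating,
    and invariant under conjugation by the lift of [torus a], which multiplies
    both arguments by [a ^- 2]. *)
Lemma upper_lifts_commute e e' t u :
  p e = rho (U t) -> p e' = rho (U u) -> commute e e'.
Proof.
move=> pe pe'; apply/commgP/eqP.
pose f t u := [~ l (U t), l (U u)].
have plU s : p (l (U s)) = rho (U s) by rewrite pl ?det_upper.
have fE x x' s s' : p x = rho (U s) -> p x' = rho (U s') -> [~ x, x'] = f s s'.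
  by move=> px px'; apply: (central_comm pC); rewrite plU.
have pf s s' : p (f s s') = 1.
  by rewrite gmulfR !plU; apply/eqP/commgP/rho_upper_commute.
rewrite (fE _ _ _ _ pe pe'); apply: (square_invariant_alternating q4 q9).
- move=> s s' r; rewrite -(fE (l (U s) * l (U s')) (l (U r))) // ?gmulfM ?plU //.
  by rewrite commMgJ central_fix ?pf.
- move=> r s s'; rewrite -(fE (l (U r)) (l (U s') * l (U s))) // ?gmulfM ?plU //.
    by rewrite commgMJ central_fix ?pf.
  by rewrite addrC rho_upperD.
- by move=> s; apply: commgg.
move=> a s s' nza; rewrite -[LHS](central_fix (l (D a)) (pf _ _)) conjRg.
have plUJ r : p (l (U (a ^+ 2 * r)) ^ l (D a)) = rho (U r).
  apply: overJ (plU _) (pl (det_torus nza)); rewrite ?det_upper ?det_torus //.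
  by rewrite upper_torus // mulrAC divff ?mul1r ?expf_neq0.
exact: fE.
Qed.

Section RootLift.
Variable b : F.
Hypotheses (nzb : b != 0%R) (nb2 : (b ^+ 2)%R != 1%R).
Let k := (1 - (b ^+ 2)^-1)%R.
Let nzk : k != 0%R.
Proof. by rewrite subr_eq0 eq_sym invr_eq1. Qed.

(** Since [upper t] is the commutator of [torus b] and [upper (t / k)], the
    commutator of any lifts of these matrices is a lift of [upper t] that
    depends on no choice except [b]. *)
Definition root_lift t := [~ l (D b), l (U (t / k))].
Local Notation x' := root_lift.
Local Notation "''x' t" := (root_lift t%R) (at level 8, t at level 2).

Lemma root_liftE h e t : p h = rho (D b) -> p e = rho (U (t / k)) ->
  [~ h, e] = 'x t.
Proof.
by move=> ph pe; apply: (central_comm pC); rewrite pl ?det_upper ?det_torus.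
Qed.

Lemma proj_root_lift t : p 'x t = rho (U t).
Proof.
rewrite gmulfR commgEr.
have pDU := pl (det_upper (t / k)).
have -> : (p (l (U (t / k))))^-1 ^ p (l (D b)) = rho (U (- (t / k / b ^+ 2))).
  rewrite conjVg -gmulfJ rho_upperN; congr _^-1.
  by apply: overJ pDU (pl (det_torus nzb)); rewrite ?det_upper ?det_torus
    ?upper_torus.
rewrite pDU -rho_upperD; congr (rho (U _)); rewrite /k; field.
by rewrite nzb subr_eq0 nb2.
Qed.

(** On an abelian normal subgroup, taking the commutator with a fixed element is
    a homomorphism. *)
Lemma root_liftD s t : 'x (s + t) = 'x s * 'x t.
Proof.
rewrite -(@root_liftE (l (D b)) (l (U (t / k)) * l (U (s / k)))).
- rewrite commgMJ; congr (_ * _); apply/conjg_fixP/commgP.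
  exact: upper_lifts_commute (proj_root_lift t) (pl (det_upper _)).
- by rewrite pl ?det_torus.
- by rewrite gmulfM !pl ?det_upper // -rho_upperD addrC mulrDl.
Qed.

Lemma root_liftJ e a t : a != 0%R -> p e = rho (D a) ->
  'x t ^ e = 'x (t / a ^+ 2).
Proof.
move=> nza pe; rewrite conjRg; apply: root_liftE.
  apply: overJ (pl (det_torus nzb)) pe; rewrite ?det_torus //.
  by rewrite !mul_mx2; congr mx2; ring.
apply: overJ (pl (det_upper _)) pe; rewrite ?det_torus ?det_upper //.
by rewrite upper_torus // mulrAC.
Qed.
End RootLift.

(** The Steinberg relations for [x], [y], [w] and [h], which lift [upper],
    [lower], [weyl] and [torus]. *)
Section RootRelations.
Variable x : F -> E.
Hypothesis px : forall t, p (x t) = rho (U t).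
Hypothesis xD : forall s t, x (s + t)%R = x s * x t.
Hypothesis xJ : forall e a t, a != 0%R -> p e = rho (D a) ->
  x t ^ e = x (t / a ^+ 2)%R.

Arguments x _%_R.

(* The functions [y], [w] and [h] are variables, with equations, so that they
   are not unfolded in group computations. *)
Variables y w h : F -> E.
Arguments y _%_R.
Arguments w _%_R.
Arguments h _%_R.
Hypothesis yE : forall t, y t = x (- t) ^ l (W 1).
Hypothesis wE : forall t, w t = x t * y (- t^-1) * x t.
Hypothesis hE : forall t, h t = w t * w (-1).

Let nz1 : (1 : F)%R != 0%R. Proof. exact: oner_neq0. Qed.
Let pW1 : p (l (W 1)) = rho (W 1). Proof. by rewrite pl ?det_weyl. Qed.

Let x0 : x 0 = 1.
Proof. by apply: (mulgI (x 0)); rewrite -xD addr0 mulg1. Qed.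

Let xN t : x (- t) = (x t)^-1.
Proof. by apply/esym/mulg1_eq; rewrite -xD subrr. Qed.

Let yD s t : y (s + t) = y s * y t.
Proof. by rewrite !yE opprD xD conjMg. Qed.

Let yN t : y (- t) = (y t)^-1.
Proof. by rewrite !yE xN conjVg. Qed.

Let y0 : y 0 = 1.
Proof. by rewrite yE oppr0 x0 conj1g. Qed.

Let py t : p (y t) = rho (V t).
Proof.
rewrite yE; apply: overJ (px _) pW1; rewrite ?det_upper ?det_weyl ?det_lower //.
by rewrite !mul_mx2; congr mx2; field_nz.
Qed.

Let x_weyl e t u : t != 0%R -> p e = rho (W t) -> x u ^ e = y (- (u / t ^+ 2)).
Proof.
move=> nzt pe; rewrite -[e](mulgVK (l (W 1))) conjgM (xJ _ nzt) ?yE ?opprK //.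
rewrite pM pV pW1 pe; apply: (mulIg (rho (W 1))); rewrite mulgVK.
rewrite -rhoM ?det_torus ?det_weyl // mul_mx2; congr (rho (mx2 _ _ _ _));
  by field_nz.
Qed.

Let y_weyl e t u : t != 0%R -> p e = rho (W t) -> y u ^ e = x (- (u * t ^+ 2)).
Proof.
move=> nzt pe; have nzV : (- t^-1 != 0)%R by rewrite oppr_eq0 invr_eq0.
rewrite yE -conjgM (xJ _ nzV).
  by congr x; field_nz.
rewrite pM pW1 pe -rhoM ?det_weyl // mul_mx2; congr (rho (mx2 _ _ _ _));
  by field_nz.
Qed.

Let y_torus e a u : a != 0%R -> p e = rho (D a) -> y u ^ e = y (u * a ^+ 2).
Proof.
move=> nza pe; have nzV : (a^-1 != 0)%R by rewrite invr_eq0.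
rewrite !yE -conjgM -[l _ * e](mulgVK (l (W 1))) conjgM (xJ _ nzV).
  by congr (x _ ^ _); field_nz.
rewrite !pM pV pW1 pe; apply: (mulIg (rho (W 1))); rewrite mulgVK.
rewrite -!rhoM ?det_torus ?det_weyl // !mul_mx2; congr (rho (mx2 _ _ _ _));
  by field_nz.
Qed.

Let pw t : t != 0%R -> p (w t) = rho (W t).
Proof.
move=> nzt; rewrite wE !pM !px py -!rhoM ?det_mulmx ?det_upper ?det_lower
  ?mulr1 //.
by rewrite !mul_mx2; congr (rho (mx2 _ _ _ _)); field_nz.
Qed.

Let wN t : w (- t) = (w t)^-1.
Proof. by rewrite !wE invrN opprK !invgM -!xN -yN opprK mulgA. Qed.

(** [w t] is invariant under conjugation by itself, which exchanges the two kinds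
    of root elements. *)
Let wE' t : t != 0%R -> w t = y (- t^-1) * x t * y (- t^-1).
Proof.
move=> nzt; have -> : w t = w t ^ w t by rewrite conjgE mulKg.
rewrite {1}wE !conjMg !(x_weyl _ nzt (pw nzt)) (y_weyl _ nzt (pw nzt)).
by congr (y _ * x _ * y _); field_nz.
Qed.

Let w_torus e a t : a != 0%R -> t != 0%R -> p e = rho (D a) ->
  w t ^ e = w (t / a ^+ 2).
Proof.
move=> nza nzt pe; rewrite !wE !conjMg !(xJ _ nza pe) (y_torus _ nza pe).
by congr (x _ * y _ * x _); field_nz.
Qed.

Let w_weyl e s t : s != 0%R -> t != 0%R -> p e = rho (W s) ->
  w t ^ e = w (s ^+ 2 / t).
Proof.
move=> nzs nzt pe; rewrite {1}wE !conjMg !(x_weyl _ nzs pe) (y_weyl _ nzs pe).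
rewrite wE' ?mulf_neq0 ?invr_eq0 ?expf_neq0 //.
by congr (y _ * x _ * y _); field_nz.
Qed.

Let ph t : t != 0%R -> p (h t) = rho (D t).
Proof.
move=> nzt; have nzN1 : (-1 : F)%R != 0%R by rewrite oppr_eq0.
rewrite hE pM !pw // -rhoM ?det_weyl // mul_mx2.
by congr (rho (mx2 _ _ _ _)); field_nz.
Qed.

Let wh t : w t = h t * w 1.
Proof. by rewrite hE wN mulgVK. Qed.

Let h1 : h 1 = 1.
Proof. by rewrite hE wN mulgV. Qed.

(** The diagonal group is cyclic, so that its preimage is cyclic modulo a central
    subgroup. *)
Let torus_lifts_commute e e' a a' : a != 0%R -> a' != 0%R ->
  p e = rho (D a) -> p e' = rho (D a') -> commute e e'.
Proof.
have [v nzv vP] := finField_mulgen F.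
have gen d r : r != 0%R -> p d = rho (D r) -> exists k, exists2 z, (forall g,
  commute z g) & d = h v ^+ k * z.
  move=> nzr pd; have [k rk] := vP r nzr; exists k; apply: (central_ker pC).
  rewrite pd rk (gmulfXn p) ph //; elim: k {rk} => [|k IHk].
    by rewrite expg0 -rho1 -mx2_1; congr (rho (mx2 _ _ _ _));
      rewrite ?expr0 ?invr1.
  rewrite expgS IHk -rhoM ?det_torus ?expf_neq0 // mul_mx2.
  by congr (rho (mx2 _ _ _ _)); rewrite ?exprS ?invfM; ring.
move=> nza nza' pe pe'; have [k [z zC ->]] := gen _ _ nza pe.
have [k' [z' zC' ->]] := gen _ _ nza' pe'.
apply: commuteM; last exact/commute_sym/zC'.
apply/commute_sym/commuteM; last exact/commute_sym/zC.
exact/commuteX2/commute_refl.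
Qed.

(** [h u] commutes with [h a^-1]; on the other hand conjugation by the latter
    multiplies the arguments of [w] by [a ^+ 2]. *)
Let h_sqr a u : a != 0%R -> u != 0%R -> h (a ^+ 2 * u) = h u * h (a ^+ 2).
Proof.
move=> nza nzu; have nzV : (a^-1 != 0)%R by rewrite invr_eq0.
have nzN1 : (-1 : F)%R != 0%R by rewrite oppr_eq0.
have: h u ^ h a^-1 = h u.
  by rewrite conjgE (torus_lifts_commute nzu nzV (ph nzu) (ph nzV)) mulKg.
rewrite {1}hE conjMg !(w_torus nzV _ (ph nzV)) // exprVn !invrK mulN1r mulrC =>
  <-.
by rewrite !hE !wN -!mulgA mulKg.
Qed.

Let xE u : u != 0%R -> x u = y u^-1 * w u * y u^-1.
Proof.
by move=> nzu; rewrite wE' // !mulgA -yD subrr y0 mul1g -mulgA -yD addNr y0 mulg1.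
Qed.

Let x_y_conj s u : u != 0%R -> x u * y s * x (- u) = y u^-1 * x (- (u ^+ 2 *
  s)) * y (- u^-1).
Proof.
move=> nzu; have nzNu : (- u != 0)%R by rewrite oppr_eq0.
rewrite (xE nzu) (xE nzNu) invrN.
have -> : x (- (u ^+ 2 * s)) = y s ^ w (- u).
  by rewrite (y_weyl _ nzNu (pw nzNu)) sqrrN mulrC.
rewrite conjgE wN invgK -!mulgA; do 2!congr (_ * _).
by rewrite !mulgA -!yD addrAC subrr add0r.
Qed.

(** This ties [h] to addition in the field. Expanding [w u],
    [w (-1)] and [w v] in the form of [wE'], the assumption [u + v = 1] lets one
    merge the lower factors in the middle and split [x (-1)]; what remains are
    two conjugates computed by [x_y_conj], and a product equal to [w (u * v)]. *)
Let steinberg_rel u v : u != 0%R -> v != 0%R -> (u + v = 1)%R ->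
  h u * h v = h (u * v).
Proof.
move=> nzu nzv uv1; have nzN1 : (-1 : F)%R != 0%R by rewrite oppr_eq0.
rewrite !hE mulgA; congr (_ * _).
have uv : (- u^-1 + - (-1)^-1 = - (v / u))%R.
  by rewrite -[v](addKr u) uv1; field_nz.
have vu : (- (-1)^-1 + - v^-1 = - (u / v))%R.
  by rewrite -[u](addrK v) uv1; field_nz.
have xN1 : x (-1) = x (- u) * x (- v) by rewrite -xD -opprD uv1.
transitivity (y (- u^-1) * (x u * y (- (v / u)) * x (- u)) *
  (x (- v) * y (- (u / v)) * x (- - v)) * y (- v^-1)).
  by rewrite !wE' // opprK -uv -vu !yD xN1 !mulgA.
rewrite !x_y_conj ?oppr_eq0 // !mulgA -yD addNr y0 mul1g.
rewrite -[_ * y (- (- v)^-1) * _]mulgA -yD invrN opprK subrr y0 mulg1.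
rewrite -[_ * y (- u^-1) * _]mulgA -yD wE; congr (x _ * y _ * x _).
- by field_nz.
- by rewrite -[((u * v)^-1)%R]mul1r -uv1; field_nz.
- by field_nz.
Qed.

(** If one factor is a square this is [h_sqr]. Otherwise both are square
    multiples of two given nonsquares of sum 1. *)
Let hM t u : t != 0%R -> u != 0%R -> h (t * u) = h t * h u.
Proof.
move=> nzt nzu; have commh r s := @torus_lifts_commute (h r) (h s) r s.
have [/is_squareP[a ta]|nst] := boolP (t \in @is_square F).
  have nza : a != 0%R by apply: contraNneq nzt => a0; rewrite ta a0 expr0n.
  by rewrite ta h_sqr // commh ?ph ?expf_neq0.
have [/is_squareP[a ua]|nsu] := boolP (u \in @is_square F).
  have nza : a != 0%R by apply: contraNneq nzu => a0; rewrite ua a0 expr0n.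
  by rewrite ua mulrC h_sqr.
have [n nsn nsm] := nonsquare_sum1 (nonsquare_char nst);
  set m := (1 - n)%R in nsm.
have sq0 : (0 : F)%R \in @is_square F by apply/is_squareP; exists 0%R;
  rewrite expr0n.
have nzn : n != 0%R by apply: contraNneq nsn => ->.
have nzm : m != 0%R by apply: contraNneq nsm => ->.
have [a nza ->] := nonsquare_div nst nsn; have [b nzb ->]
  := nonsquare_div nsu nsm.
have nma : ((n * a ^+ 2) * (m * b ^+ 2) = (a * b) ^+ 2 * (n * m))%R by ring.
rewrite nma h_sqr ?mulf_neq0 // -steinberg_rel //; last by rewrite /m addrC subrK.
rewrite exprMn h_sqr ?expf_neq0 // [(n * _)%R]mulrC [(m * _)%R]mulrC !h_sqr //.
rewrite -!mulgA; congr (_ * _); rewrite mulgA.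
by apply/esym/commuteM; apply: commh; rewrite ?ph ?expf_neq0.
Qed.

Let h_w a t : a != 0%R -> t != 0%R -> h a * w t = w (a * t).
Proof. by move=> nza nzt; rewrite (wh t) mulgA -hM // -wh. Qed.

Let w_h t a : t != 0%R -> a != 0%R -> w t * h a = w (t / a).
Proof.
move=> nzt nza; have nzN1 : (-1 : F)%R != 0%R by rewrite oppr_eq0.
have w1h : w 1 * h a = h a^-1 * w 1.
  rewrite conjgCV -wN [h a]hE conjMg (w_weyl nzN1 nza (pw nzN1)).
  by rewrite [w (-1) ^ _]conjgE mulKg sqrrN expr1n div1r -hE.
by rewrite wh -mulgA w1h mulgA -hM ?invr_eq0 // -wh.
Qed.

Let w_w t s : t != 0%R -> s != 0%R -> w t * w s = h (- (t / s)).
Proof.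
move=> nzt nzs; have nzNs : (- s != 0)%R by rewrite oppr_eq0.
have -> : w t = h (- (t / s)) * w (- s).
  rewrite h_w ?oppr_eq0 ?mulf_neq0 ?invr_eq0 //; congr w; field_nz.
by rewrite wN mulgVK.
Qed.

(** The factors lift those of the Bruhat decomposition in [SL2_weyl_ind]. *)
Definition bruhat_lift (A : 'M[F]_2) : E :=
  let: (a, b, c, d) := (A 0%R 0%R, A 0%R 1%R, A 1%R 0%R, A 1%R 1%R) in
  if c == 0%R then x (b / d) * h a
  else x (a / c) * w (- c^-1) * x (d / c).

Let bruhat_mx2 a b c d : bruhat_lift (mx2 a b c d) =
  if c == 0%R then x (b / d) * h a
  else x (a / c) * w (- c^-1) * x (d / c).
Proof. by rewrite /bruhat_lift !mxE. Qed.

Let bruhat_upper r A : (\det A = 1)%R -> bruhat_lift (U r *m A)%R = x r *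
  bruhat_lift A.
Proof.
rewrite (mx2_eta A) det_mx2 mul_mx2 !bruhat_mx2.
move: (A 0%R 0%R) (A 0%R 1%R) (A 1%R 0%R) (A 1%R 1%R) => a b c d detA.
rewrite !(mul0r, mul1r, add0r); case: eqP => [c0|/eqP nzc].
  have nzd : d != 0%R.
    by apply: contra_eq_neq detA => ->; rewrite c0 !mulr0 subrr eq_sym oner_neq0.
  by rewrite c0 mulr0 addr0 mulgA -xD; congr (x _ * _); field_nz.
by rewrite !mulgA -xD; congr (x _ * _ * _); field_nz.
Qed.

(** Multiplication by [weyl t] may change the Bruhat cell, according to which of
    the entries in the first column vanish. *)
Let bruhat_weyl t A : t != 0%R -> (\det A = 1)%R ->
  bruhat_lift (W t *m A)%R = w t * bruhat_lift A.
Proof.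
move=> nzt; rewrite (mx2_eta A) det_mx2 mul_mx2 !bruhat_mx2.
move: (A 0%R 0%R) (A 0%R 1%R) (A 1%R 0%R) (A 1%R 1%R) => a b c d detA.
rewrite !(mul0r, add0r, addr0) mulf_eq0 oppr_eq0 invr_eq0 (negPf nzt) /=.
case: (eqVneq a 0%R) => [a0|nza]; case: (eqVneq c 0%R) => [c0|nzc].
- by move/eqP: detA; rewrite a0 c0 mul0r mulr0 subrr eq_sym oner_eq0.
- have nzs : (- c^-1 != 0)%R by rewrite oppr_eq0 invr_eq0.
  have bE : b = (- c^-1)%R.
    by rewrite -[LHS](mulfK nzc) -[(b * c)%R]opprK -[X in (- X)%R]add0r -[X in
      (X + _)%R](mul0r d) -a0 detA mulN1r.
  have nzk : (t * c != 0)%R by rewrite mulf_neq0.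
  rewrite [LHS]conjgC (xJ _ nzk) ?ph // a0 mul0r x0 mul1g mulgA w_w // bE.
  by congr (h _ * x _); field_nz.
- have dE : d = (a^-1)%R.
    by rewrite -[d](mulKf nza) -[(a * d)%R](subrK (b * c)%R) detA c0 mulr0
      addr0 mulr1.
  rewrite c0 mulr0 mul0r x0 mul1g (conjgC (x _)) (xJ _ nza) ?ph // mulgA w_h //
    dE.
  by congr (w _ * x _); field_nz.
have nzs : (a / c != 0)%R by rewrite mulf_neq0 ?invr_eq0.
have nzV : (- c^-1 != 0)%R by rewrite oppr_eq0 invr_eq0.
have nzNt : (- t != 0)%R by rewrite oppr_eq0.
have bE : b = ((a * d - 1) / c)%R by rewrite -detA opprB addrC subrK mulfK.
(* In the generic case, [x (a / c)] is expanded by [xE]; its outer factors are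
   moved across the adjacent [w], where they become values of [x]. *)
rewrite (xE nzs) !mulgA (conjgCV (w t)) -wN (y_weyl _ nzNt (pw nzNt)).
rewrite -(mulgA _ (y _) (w _)) (conjgC (y _)) (y_weyl _ nzV (pw nzV)).
have nzk : (- (t / (a / c)) != 0)%R by rewrite oppr_eq0 mulf_neq0 ?invr_eq0.
rewrite -!mulgA -xD (mulgA (w t)) w_w // (mulgA (h _)) h_w // !mulgA bE.
by congr (x _ * w _ * x _); field_nz.
Qed.

Lemma proj_bruhat_lift A : (\det A = 1)%R -> p (bruhat_lift A) = rho A.
Proof.
rewrite (mx2_eta A) det_mx2 !bruhat_mx2.
move: (A 0%R 0%R) (A 0%R 1%R) (A 1%R 0%R) (A 1%R 1%R) => a b c d detA.
case: (eqVneq c 0%R) => [c0|nzc].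
  have nza : a != 0%R.
    by apply: contra_eq_neq detA => ->; rewrite c0 mul0r mulr0 subrr eq_sym
      oner_neq0.
  have dE : d = (a^-1)%R by rewrite -[d](mulKf nza) -[(a * d)%R](subrK (b *
    c)%R) detA c0 mulr0 addr0 mulr1.
  rewrite pM px ph // -rhoM ?det_upper ?det_torus // mul_mx2 c0 dE.
  by congr (rho (mx2 _ _ _ _)); field_nz.
have nzV : (- c^-1 != 0)%R by rewrite oppr_eq0 invr_eq0.
have bE : b = ((a * d - 1) / c)%R by rewrite -detA opprB addrC subrK mulfK.
rewrite !pM !px pw // -!rhoM ?det_mulmx ?det_upper ?det_weyl ?mulr1 //
  !mul_mx2 bE.
by congr (rho (mx2 _ _ _ _)); field_nz.
Qed.

(** The left factors for which this holds form a monoid, and it contains the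
    generators of [SL2_weyl_ind]. *)
Lemma bruhat_liftM A B : (\det A = 1)%R -> (\det B = 1)%R ->
  bruhat_lift (A *m B)%R = bruhat_lift A * bruhat_lift B.
Proof.
pose good A := (\det A = 1)%R /\ forall B, (\det B = 1)%R ->
  bruhat_lift (A *m B)%R = bruhat_lift A * bruhat_lift B.
have goodM A1 A2 : good A1 -> good A2 -> good (A1 *m A2)%R.
  case=> d1 g1 [d2 g2]; split=> [|B' dB]; first by rewrite det_mulmx d1 d2 mulr1.
  by rewrite -mulmxA !g1 ?g2 ?det_mulmx ?d2 ?dB ?mulr1 // mulgA.
have goodU r : good (U r).
  split=> [|B' dB]; first exact: det_upper.
  by rewrite bruhat_upper // bruhat_mx2 eqxx divr1 h1 mulg1.
have goodW t : t != 0%R -> good (W t).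
  move=> nzt; split=> [|B' dB]; first exact: det_weyl.
  rewrite bruhat_weyl // bruhat_mx2 oppr_eq0 invr_eq0 (negPf nzt) !mul0r x0.
  by rewrite mul1g mulg1 invrN opprK invrK.
move=> detA; suff [_ +] : good A by apply.
exact: SL2_weyl_ind detA.
Qed.

End RootRelations.
End Lifting.

(** The Schur multiplier of SL(2,q) is trivial. *)
Theorem SL2_central_lift (F : finFieldType) (E Q : groupType)
    (p : UMagmaMorphism.type E Q) (rho : 'M[F]_2 -> Q) :
    4 < #|F| -> #|F| != 9 ->
    (forall u v, p u = 1 -> commute u v) ->
    (forall A B, (\det A = 1)%R -> (\det B = 1)%R ->
       rho (A *m B)%R = rho A * rho B) ->
    (forall A, (\det A = 1)%R -> exists e, p e = rho A) ->
  exists phi : 'M[F]_2 -> E,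
    (forall A B, (\det A = 1)%R -> (\det B = 1)%R ->
       phi (A *m B)%R = phi A * phi B) /\
    (forall A, (\det A = 1)%R -> p (phi A) = rho A).
Proof.
move=> q4 q9 pC rhoM p_onto.
have [l pl] : exists l : 'M[F]_2 -> E, forall A, (\det A = 1)%R ->
  p (l A) = rho A.
  have /choice[l pl] A : exists e, (\det A = 1)%R -> p e = rho A.
    by have [/p_onto[e pe]|/eqP nd] := eqVneq (\det A)%R 1%R;
      [exists e | exists 1].
  by exists l.
have [b nzb nb2] : exists2 b : F, b != 0%R & (b ^+ 2)%R != 1%R.
  by apply: exists_expn_neq1 => //; apply: leq_trans q4.
pose x := root_lift l b.
pose y t := x (- t)%R ^ l (weyl 1).
pose w t := x t * y (- t^-1)%R * x t.
pose h t := w t * w (-1)%R.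
have px : forall t, p (x t) = rho (upper t) by apply: proj_root_lift.
exists (bruhat_lift x w h); split=> [A B detA detB|A detA].
  apply: (bruhat_liftM pC rhoM pl px _ _ (y := y)) => // [s t|e a t nza pe].
    apply: (root_liftD q4 q9 pC rhoM pl nzb nb2).
  apply: (root_liftJ pC rhoM pl nzb _ nza pe).
exact: (proj_bruhat_lift rhoM pl px (y := y)).
Qed.

(** * The projective special linear group *)

Section ProjectiveLine.
Variable F : finFieldType.
Implicit Types (A B : 'M[F]_2) (g : {'GL_2[F]}).

Local Notation Z := ('Z(SL2 F)).

Definition GL2_mx A : {'GL_2[F]} := insubd (1 : {'GL_2[F]}) A.

Lemma GL2_mxE A : (\det A = 1)%R -> GLval (GL2_mx A) = A.
Proof.
by move=> dA; rewrite /GL2_mx insubdK // -topredE /= unitmxE dA unitr1.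
Qed.

Lemma GL2_mxK g : GL2_mx (GLval g) = g.
Proof. exact: valKd. Qed.

Lemma GL2_mx_SL2 A : (\det A = 1)%R -> GL2_mx A \in SL2 F.
Proof. by move=> dA; rewrite inE GL2_mxE // dA. Qed.

Lemma SL2_det g : g \in SL2 F -> (\det (GLval g) = 1)%R.
Proof. by rewrite inE => /eqP. Qed.

Lemma GL2_mxM A B : (\det A = 1)%R -> (\det B = 1)%R ->
  GL2_mx (A *m B)%R = GL2_mx A * GL2_mx B.
Proof.
move=> dA dB; apply: val_inj; rewrite [RHS]GL_MxE /= -!/(GLval _) !GL2_mxE //.
by rewrite det_mulmx dA dB mulr1.
Qed.

Definition PSL2_mx A : coset_of Z := coset Z (GL2_mx A).

Lemma SL2_norm g : g \in SL2 F -> g \in 'N(Z).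
Proof. exact: (subsetP (normal_norm (center_normal _))). Qed.

Lemma PSL2_mxM A B : (\det A = 1)%R -> (\det B = 1)%R ->
  PSL2_mx (A *m B)%R = PSL2_mx A * PSL2_mx B.
Proof. by move=> dA dB; rewrite /PSL2_mx GL2_mxM // morphM //
  SL2_norm ?GL2_mx_SL2. Qed.

Lemma PSL2_mx_in A : (\det A = 1)%R -> PSL2_mx A \in PSL2 F.
Proof. by move=> dA; rewrite mem_quotient ?GL2_mx_SL2. Qed.

Lemma PSL2P u :
  reflect (exists2 A, (\det A = 1)%R & u = PSL2_mx A) (u \in PSL2 F).
Proof.
apply: (iffP idP) => [/morphimP[g _ gS ->]|[A dA ->]]; last exact: PSL2_mx_in.
by exists (GLval g); rewrite ?SL2_det // /PSL2_mx GL2_mxK.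
Qed.

Lemma PSL2_mx1 : PSL2_mx 1%:M%R = 1.
Proof. by apply: (mulgI (PSL2_mx 1%:M%R)); rewrite -PSL2_mxM ?det1 //
  mulmx1 mulg1. Qed.

Lemma detN1 : (\det (- 1%:M : 'M[F]_2) = 1)%R.
Proof. by rewrite -mx2_1 -scaleN1r detZ mx2_1 det1 mulr1 sqrrN expr1n. Qed.

(** A central matrix commutes with [upper 1] and [lower 1], hence is scalar. *)
Lemma center_SL2P A : (\det A = 1)%R ->
  reflect (A = 1%:M \/ A = - 1%:M)%R (GL2_mx A \in Z).
Proof.
move=> dA; apply: (iffP idP) => [/centerP[_ zA]|].
  have comA B : (\det B = 1)%R -> (A *m B = B *m A)%R.
    move=> dB; have /(congr1 (@GLval 2 F)) := zA _ (GL2_mx_SL2 dB).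
    by rewrite -!GL2_mxM // !GL2_mxE // det_mulmx dA dB mulr1.
  have AE := centralizing_scalar (comA _ (det_upper 1)) (comA _ (det_lower 1)).
  move: dA; rewrite AE det_scalar => /eqP; rewrite sqrf_eq1 => /orP[]/eqP->.
    by left.
  by right; rewrite raddfN.
move=> AE; apply/centerP; split=> [|g gS]; first exact: GL2_mx_SL2.
rewrite /commute -[g]GL2_mxK -!GL2_mxM ?SL2_det //; congr GL2_mx.
by case: AE => ->; rewrite ?mulNmx ?mulmxN mul1mx mulmx1.
Qed.

Lemma PSL2_mx_eq1 A : (\det A = 1)%R -> PSL2_mx A = 1 <->
  (A = 1%:M \/ A = - 1%:M)%R.
Proof.
move=> dA; split=> [/coset_idr AZ|/(center_SL2P dA)]; last exact: coset_id.
by apply/(center_SL2P dA)/AZ; rewrite SL2_norm ?GL2_mx_SL2.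
Qed.

Lemma PSL2_mx_eq A B : (\det A = 1)%R -> (\det B = 1)%R ->
  PSL2_mx A = PSL2_mx B -> (A = B \/ A = - B)%R.
Proof.
move=> dA dB eAB.
have uB : B \in unitmx by rewrite unitmxE dB unitr1.
have dBi : (\det (invmx B) = 1)%R by rewrite det_inv dB invr1.
have : PSL2_mx (A *m invmx B)%R = 1 by rewrite PSL2_mxM // eAB -PSL2_mxM //
  mulmxV // PSL2_mx1.
case/PSL2_mx_eq1; first by rewrite det_mulmx dA dBi mulr1.
  by move/(congr1 (mulmxr B)); rewrite /= mulmxKV // mul1mx; left.
by move/(congr1 (mulmxr B)); rewrite /= mulmxKV // mulNmx mul1mx; right.
Qed.

Lemma PSL2_mx_scalar a : (\det (a%:M : 'M[F]_2) = 1)%R -> PSL2_mx a%:M%R = 1.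
Proof.
move=> da; apply/PSL2_mx_eq1 => //; move: da.
rewrite det_scalar => /eqP; rewrite sqrf_eq1 => /orP[]/eqP->; first by left.
by right; rewrite raddfN.
Qed.

(** The matrices with image in [<<X>>] form a normal subgroup of SL(2,q) with a
    noncentral element. *)
Lemma class_gen (X : {set coset_of Z}) : 4 < #|F| ->
  X \in classes (PSL2 F) -> X != 1 -> <<X>> = PSL2 F.
Proof.
move=> q4 /imsetP[x xG defX] ntX.
have sXG : X \subset PSL2 F by rewrite defX class_subG.
apply/eqP; rewrite eqEsubset gen_subG sXG /=; apply/subsetP => u /PSL2P[B dB ->].
pose N A := (\det A = 1)%R /\ PSL2_mx A \in <<X>>.
suff: N B by case.
have /PSL2P[A dA xE] := xG.
apply: (@SL2_normal_full F N q4 _ _ _ _ A) dB =>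
  [C []//|C D [dC NC] [dD ND]|C D [dC NC] CD|C D E dD CD [dC NC]||a].
- by split; rewrite ?PSL2_mxM ?groupM // det_mulmx dC dD mulr1.
- have dD : (\det D = 1)%R by have := congr1 determinant CD;
    rewrite det_mulmx dC mul1r det1.
  by split=> //; rewrite -groupV in NC; rewrite -(mulg1_eq (_ :
    PSL2_mx C * PSL2_mx D = 1)) // -PSL2_mxM // CD PSL2_mx1.
- have dE : (\det E = 1)%R.
    by have := congr1 determinant CD; rewrite !det_mulmx dC dD mulr1 mul1r.
  split=> //; have -> : PSL2_mx E = PSL2_mx C ^ PSL2_mx D.
    by apply: (mulgI (PSL2_mx D)); rewrite -conjgC -!PSL2_mxM // CD.
  rewrite memJ_norm //; apply: (subsetP (norms_gen _) _ (PSL2_mx_in dD)).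
  by rewrite defX class_norm.
- by split=> //; rewrite mem_gen // defX -xE class_refl.
apply: contra ntX => /eqP AE.
by rewrite defX xE AE PSL2_mx_scalar -?AE // class1G.
Qed.

(** By the theorem of Cayley and Hamilton, [A ^+ 2] is [\tr A *: A - 1]; it is
    scalar, for [A] not scalar, only if the trace is 0. *)
Lemma PSL2_mx_order2 A : (2 != 0 :> F)%R -> (\det A = 1)%R ->
  #[PSL2_mx A] = 2 <-> (\tr A = 0)%R.
Proof.
move=> nz2 dA; have CH := cayley_hamilton2 dA; split=> [o2|trA].
  apply/eqP/negPn/negP => nztr.
  have [r Ar] : exists r, A = r%:M%R.
    have dAA : (\det (A *m A) = 1)%R by rewrite det_mulmx dA mulr1.
    have AA1 : PSL2_mx (A *m A)%R = 1 by rewrite PSL2_mxM // -expg2;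
      have := expg_order (PSL2_mx A); rewrite o2.
    have [] := (PSL2_mx_eq1 dAA).1 AA1.
      rewrite CH => /eqP; rewrite subr_eq -mulr2n -scaler_nat => /eqP trA.
      exists (2 / \tr A)%R; rewrite -scalemx1 mulrC -scalerA -trA scalerA.
      by rewrite mulVf // scale1r.
    rewrite CH => /eqP; rewrite subr_eq addNr scaler_eq0 (negPf nztr) => /eqP->.
    by exists 0%R; rewrite raddf0.
  by move: o2; rewrite Ar PSL2_mx_scalar ?order1 // -Ar.
apply: nt_prime_order => //.
  rewrite expg2 -PSL2_mxM // CH trA scale0r sub0r;
    by apply/(PSL2_mx_eq1 detN1); right.
apply/eqP => /(PSL2_mx_eq1 dA) AE; move/eqP: trA; apply/negP.
by case: AE => ->; rewrite ?raddfN /= ?oppr_eq0 mxtrace1.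
Qed.

(** All matrices of trace 0 and determinant 1 are conjugate in SL(2,q). *)
Lemma involution_class (X : {set coset_of Z}) A :
    (2 != 0 :> F)%R -> X \in classes (PSL2 F) ->
    (\det A = 1)%R -> PSL2_mx A \in X -> (\tr A = 0)%R ->
  X = involutions (PSL2 F).
Proof.
move=> nz2 /imsetP[x _ ->] dA /class_eqP <- trA.
apply/setP => u; rewrite inE; apply/imsetP/andP => [[v vG ->]|[/PSL2P[B dB ->]]].
  rewrite orderJ; have /PSL2_mx_order2 -> // := trA.
  by rewrite groupJ ?PSL2_mx_in.
move/eqP/PSL2_mx_order2 => -/(_ nz2 dB) trB.
have [C dC AC] := trace0_conj nz2 dA trA; have [D dD BD]
  := trace0_conj nz2 dB trB.
have uD : D \in unitmx by rewrite unitmxE dD unitr1.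
have dDi : (\det (invmx D) = 1)%R by rewrite det_inv dD invr1.
have dCD : (\det (C *m invmx D) = 1)%R by rewrite det_mulmx dC dDi mulr1.
exists (PSL2_mx (C *m invmx D)%R); first exact: PSL2_mx_in.
apply: (mulgI (PSL2_mx (C *m invmx D)%R)); rewrite -conjgC -!PSL2_mxM //;
  congr PSL2_mx.
by rewrite mulmxA AC -!mulmxA; congr (_ *m _)%R;
  rewrite -[LHS](mulmxK uD) -(mulmxA _ B) BD mulKmx.
Qed.
End ProjectiveLine.

Section SL2Perfect.
Variable F : finFieldType.
Hypothesis q4 : 4 < #|F|.

Local Notation Z := ('Z(SL2 F)).
Local Notation SL := ([subg SL2_group F]%type).

Definition SL2_mx (A : 'M[F]_2) : [subg SL2_group F] := subg _ (GL2_mx A).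

Lemma SL2_mxM A B : (\det A = 1)%R -> (\det B = 1)%R ->
  SL2_mx (A *m B)%R = SL2_mx A * SL2_mx B.
Proof. by move=> dA dB; rewrite /SL2_mx GL2_mxM // subgM ?GL2_mx_SL2. Qed.

Lemma SL2_mxE A : (\det A = 1)%R -> GLval (sgval (SL2_mx A)) = A.
Proof. by move=> dA; rewrite subgK ?GL2_mx_SL2 // GL2_mxE. Qed.

Lemma SL2_mx1 : SL2_mx 1%:M%R = 1.
Proof. by apply: (mulgI (SL2_mx 1%:M%R)); rewrite -SL2_mxM ?det1 //
  mulmx1 mulg1. Qed.

Lemma SL2_mxK (g : [subg SL2_group F]) : SL2_mx (GLval (sgval g)) = g.
Proof. by rewrite /SL2_mx GL2_mxK sgvalK. Qed.

(** Root elements are commutators with a diagonal matrix. *)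
Lemma SL2_perfect : perfect [subg SL2_group F]%type.
Proof.
pose C := comm_pred (@full_pred [subg SL2_group F]%type) (@full_pred _).
suff CS : forall A, (\det A = 1)%R -> (\det A = 1)%R /\ SL2_mx A \in C.
  by move=> g; rewrite -[g]SL2_mxK; apply: (CS _ (SL2_det (subgP g))).2.
have [b nzb nb2] : exists2 b : F, b != 0%R & (b ^+ 2)%R != 1%R.
  by apply: exists_expn_neq1 => //; apply: leq_trans q4.
have CU t : SL2_mx (upper t) \in C.
  pose u := (t / (1 - (b ^+ 2)^-1))%R.
  have -> : SL2_mx (upper t) = [~ SL2_mx (torus b), SL2_mx (upper u)].
    apply: (mulgI (SL2_mx (upper u) * SL2_mx (torus b))); rewrite -commgC.
    rewrite -!SL2_mxM ?det_mulmx ?det_upper ?det_torus ?mulr1 // !mul_mx2.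
    congr (SL2_mx (mx2 _ _ _ _)); rewrite /u; by field;
      rewrite ?subr_eq0 ?nzb ?nb2.
  exact: comm_predR.
apply: (@SL2_elementary_ind F (fun A => (\det A = 1)%R /\ SL2_mx A \in C)) =>
  [t|t|A B [dA CA] [dB CB]].
- by rewrite det_upper; split.
- split; first exact: det_lower.
  have nz1 := oner_neq0 F.
  have -> : SL2_mx (lower t) = SL2_mx (upper (- t)) ^ SL2_mx (weyl 1).
    apply: (mulgI (SL2_mx (weyl 1))); rewrite -conjgC.
    rewrite -!SL2_mxM ?det_upper ?det_lower ?det_weyl // !mul_mx2.
    by congr (SL2_mx (mx2 _ _ _ _)); field_nz.
  by apply: gpredJn; apply: CU.
by rewrite SL2_mxM // gpredM // det_mulmx dA dB mulr1.
Qed.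

Lemma SL2_proj_hom : exists k : UMagmaMorphism.type SL (coset_of Z),
  forall l, k l = PSL2_mx (GLval (sgval l)).
Proof. by apply: hom_of_morph => g h; rewrite -PSL2_mxM ?SL2_det ?subgP. Qed.

Section Projection.
Variable k : UMagmaMorphism.type SL (coset_of Z).
Hypothesis kE : forall l, k l = PSL2_mx (GLval (sgval l)).

Lemma SL2_proj_onto g : g \in PSL2 F -> exists l, k l = g.
Proof. by case/PSL2P=> A dA ->; exists (SL2_mx A); rewrite kE SL2_mxE. Qed.

Lemma SL2_proj_ker l m : k l = 1 -> commute l m.
Proof.
rewrite kE => /(PSL2_mx_eq1 (SL2_det (subgP l))) lE.
rewrite /commute -[l]SL2_mxK -[m]SL2_mxK -!SL2_mxM ?SL2_det ?subgP //.
by congr SL2_mx; case: lE => ->; rewrite ?mulNmx ?mulmxN mul1mx mulmx1.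
Qed.
End Projection.

Lemma PSL2_perfect : perfect [subg PSL2_group F]%type.
Proof.
have [k kE] := SL2_proj_hom.
have [f fE] : exists f : UMagmaMorphism.type SL [subg PSL2_group F]%type,
    forall l, f l = subg _ (k l).
  apply: hom_of_morph => l m.
  by rewrite gmulfM subgM // kE PSL2_mx_in // SL2_det ?subgP.
apply: (perfect_image (f := f) SL2_perfect) => l.
have [g gE] := SL2_proj_onto kE (subgP l).
by exists g; rewrite fE gE sgvalK.
Qed.
End SL2Perfect.

(** * The associated group of a conjugacy class *)

Section AssociatedGroupTheory.
Variables (gT : finGroupType) (X : {set gT}).

Local Notation A := (associated_group X).
Definition rack_gen (x : points X) : A :=
  qclass (normal_closure (rack_relators (X := X))) (free_gen x).

Lemma rack_ind (P : A -> Prop) :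
    P 1 -> (forall x u, P u -> P (rack_gen x * u)) ->
    (forall x u, P u -> P ((rack_gen x)^-1 * u)) ->
  forall u, P u.
Proof.
move=> P1 PM PV; elim/qclassW; apply: free_ind => [|x u|x u].
- by rewrite gmulf1.
- by rewrite gmulfM; apply: PM.
- by rewrite gmulfM gmulfV; apply: PV.
Qed.

Lemma rack_genJ (x y z : points X) : val z = val x * val y * (val x)^-1 ->
  rack_gen z = rack_gen x * rack_gen y * (rack_gen x)^-1.
Proof.
move=> zE; apply/esym/divg1_eq.
have : qclass (normal_closure (rack_relators (X := X)))
    (free_gen x * free_gen y * (free_gen x)^-1 * (free_gen z)^-1) = 1.
  apply/eqP; rewrite qclass_eq1; apply/asboolP => S; apply; apply/asboolP.
  by exists x, y, z.
by rewrite !(gmulfM, gmulfV).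
Qed.

Lemma rack_lift (H : groupType) (f : points X -> H) :
    (forall x y z, val z = val x * val y * (val x)^-1 ->
       f z = f x * f y * (f x)^-1) ->
  exists g : UMagmaMorphism.type A H, forall x, g (rack_gen x) = f x.
Proof.
move=> fJ.
have kill r : r \in normal_closure (rack_relators (X := X)) -> free_lift f r = 1.
  move=> /asboolP/(_ (ker_pred (free_lift f))) kr; apply/eqP/kr => {kr r}.
  move=> _ /asboolP[x [y [z [/fJ zE ->]]]].
  by rewrite unfold_in !(gmulfM, gmulfV) /= !free_lift_gen zE mulgV.
have [g gE] := quotient_lift kill.
by exists g => x; rewrite -[RHS](free_lift_gen f); exact: gE.
Qed.

Lemma rack_hom_eq (H : groupType) (f g : UMagmaMorphism.type A H) :
  (forall x, f (rack_gen x) = g (rack_gen x)) -> forall u, f u = g u.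
Proof.
move=> fg; apply: rack_ind => [|x u fgu|x u fgu]; first by rewrite !gmulf1.
  by rewrite !gmulfM fg fgu.
by rewrite !gmulfM !gmulfV fg fgu.
Qed.

Section Action.
Variable p : UMagmaMorphism.type A gT.
Hypothesis p_gen : forall x, p (rack_gen x) = val x.
Hypothesis XJ : forall x y, x \in X -> y \in X -> y ^ x \in X.

(** As(X) acts on its generators by conjugation as its image in the group acts
    on [X]; in particular the kernel of this image is central. *)
Lemma rack_gen_act u (y z : points X) : val z = p u * val y * (p u)^-1 ->
  rack_gen z = u * rack_gen y * u^-1.
Proof.
elim/rack_ind: u y z => [|x u IHu|x u IHu] y z.
- by rewrite !gmulf1 !invg1 !mulg1 !mul1g => /val_inj->.
- rewrite gmulfM p_gen => zE; pose m : points X := exist (fun a =>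
    a \in X) _ (XJ (valP x) (valP z)).
  have /IHu mE : val m = p u * val y * (p u)^-1.
    by rewrite /= zE conjgE invgM !mulgA mulVg mul1g mulgVK.
  have zm : val z = val x * val m * (val x)^-1.
    by rewrite /= conjgE !mulgA mulgV mul1g mulgK.
  by rewrite (rack_genJ zm) mE invgM !mulgA.
rewrite gmulfM gmulfV p_gen invgM invgK => zE.
have xzX : (val z) ^ (val x)^-1 \in X.
  have xN : val x \in 'N(X).
    rewrite inE; apply/subsetP => _ /imsetP[y' y'X ->]; exact: XJ (valP x) y'X.
  by rewrite memJ_norm ?groupV // (valP z).
pose m : points X := exist (fun a => a \in X) _ xzX.
have /IHu mE : val m = p u * val y * (p u)^-1.
  by rewrite /= zE conjgE !invgK !mulgA mulgV mul1g mulgK.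
have zm : val m = val x * val z * (val x)^-1 by rewrite /= conjgE invgK mulgA.
move: (rack_genJ zm); rewrite mE => /(congr1 (fun v =>
  (rack_gen x)^-1 * v * rack_gen x)).
by rewrite !mulgA mulVg mul1g mulgVK invgM invgK !mulgA => <-.
Qed.

Lemma rack_ker_central u v : p u = 1 -> commute u v.
Proof.
move=> pu1; have comx x : commute u (rack_gen x).
  have /rack_gen_act xE : val x = p u * val x * (p u)^-1.
    by rewrite pu1 invg1 mulg1 mul1g.
  by rewrite /commute [in RHS]xE mulgVK.
elim/rack_ind: v => [|x v|x v]; first exact: commute1.
  exact: commuteM.
by apply: commuteM; apply: commuteV.
Qed.
End Action.
End AssociatedGroupTheory.

(** [L] is a perfect central cover of [G], with a homomorphism [psi] to As(X) over
    [G] and a section [s] of [X] that is equivariant under [L]. *)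
Section AssociatedGroupIso.
Variables (gT : finGroupType) (G : {group gT}) (X : {set gT}) (x0 : points X).
Hypothesis defX : X = val x0 ^: G.
Hypothesis sXG : X \subset G.
Local Notation A := (associated_group X).
Variable p : UMagmaMorphism.type A gT.
Hypothesis p_gen : forall x, p (rack_gen x) = val x.
Variables (L : groupType) (k : UMagmaMorphism.type L gT).
Hypothesis perfL : perfect L.
Hypothesis k_onto : forall g, g \in G -> exists l, k l = g.
Hypothesis k_ker : forall l m, k l = 1 -> commute l m.
Variables (s : points X -> L) (psi : UMagmaMorphism.type L A).
Hypothesis ks : forall x, k (s x) = val x.
Hypothesis sJ : forall l x y, val y = k l * val x * (k l)^-1 ->
  s y = l * s x * l^-1.
Hypothesis p_psi : forall l, p (psi l) = k l.

Lemma class_closed x y : x \in X -> y \in X -> y ^ x \in X.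
Proof.
move=> xX yX; rewrite memJ_norm //; apply: subsetP (subsetP sXG _ xX).
by rewrite defX class_norm.
Qed.

(** The isomorphism sends the generator at [x] to [(s x, 1)]. It is a retraction
    of [psi] because [L] is perfect. The element [z = (psi (s x0))^-1 * rack_gen x0]
    is central, and equivariance of [s] shows that it does not depend on [x0], so
    that every element of As(X) is the product of a value of [psi] by a power of
    [z]. *)
Lemma associated_group_iso : group_iso A (L * Zgroup)%type.
Proof.
have pC := rack_ker_central p_gen class_closed.
have [|Phi PhiE] := @rack_lift _ X (L * Zgroup)%type (fun x => (s x, 1%R : int)).
  by move=> x y z zE; congr pair; apply: sJ; rewrite ks.
have [k1 k1E] : exists k1 : UMagmaMorphism.type A gT, forall u, k1 u = k (Phi
  u).1.
  by apply: hom_of_morph => u v; rewrite !gmulfM.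
have kPhi u : k (Phi u).1 = p u.
  by rewrite -k1E; apply: rack_hom_eq => x; rewrite k1E PhiE p_gen ks.
have [f1 f1E] : exists f1 : UMagmaMorphism.type L L, forall l, f1 l = (Phi (psi
  l)).1.
  by apply: hom_of_morph => u v; rewrite !gmulfM.
have [f2 f2E] : exists f2 : UMagmaMorphism.type L Zgroup, forall l, f2 l = (Phi
  (psi l)).2.
  by apply: hom_of_morph => u v; rewrite !gmulfM.
have [one oneE] : exists one : UMagmaMorphism.type L Zgroup, forall l, one l = 1.
  by apply: hom_of_morph => u v; rewrite mulg1.
have Phi_psi l : Phi (psi l) = (l, 1).
  rewrite [LHS]surjective_pairing -f1E -f2E; congr pair.
    apply: (perfect_hom_eq (g := idfun) perfL) => m e; apply: k_ker.
    by rewrite gmulfM gmulfV f1E kPhi p_psi mulVg.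
  by rewrite -[RHS](oneE l); apply: perfect_hom_eq => // m e; apply: addrC.
have [z [zE zC Phi_z]] : exists z, [/\ rack_gen x0 = psi (s x0) * z,
    forall v, commute z v & Phi z = (1, 1%R : int)].
  exists ((psi (s x0))^-1 * rack_gen x0); split; first by rewrite mulVKg.
    by move=> v; apply: pC; rewrite gmulfM gmulfV p_psi ks p_gen mulVg.
  by rewrite gmulfM gmulfV Phi_psi PhiE; congr pair; rewrite /= ?mulVg.
have genE x : rack_gen x = psi (s x) * z.
  have /imsetP[g gG xE] : val x \in val x0 ^: G by rewrite -defX (valP x).
  have [l lE] := k_onto (groupVr gG).
  have xE' : val x = k l * val x0 * (k l)^-1 by rewrite lE invgK xE conjgE mulgA.
  rewrite (sJ xE').
  rewrite (rack_gen_act p_gen class_closed (u := psi l) (y := x0)) ?p_psi //.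
  by rewrite zE !gmulfM gmulfV -!mulgA zC.
have nf u : exists l m n, u = psi l * z ^+ m * z ^- n.
  have zV v : commute z^-1 v by apply/commute_sym/commuteV/commute_sym.
  elim/rack_ind: u => [|x u [l [m [n ->]]]|x u [l [m [n ->]]]].
  - by exists 1, 0, 0; rewrite gmulf1 !expg0 invg1 !mulg1.
  - exists (s x * l), m.+1, n; rewrite genE gmulfM expgS -!mulgA; congr (_ * _).
    by rewrite !mulgA zC.
  exists ((s x)^-1 * l), m, n.+1.
  rewrite genE invgM gmulfM gmulfV zV expgS invgM -!mulgA; congr (_ * _).
  by rewrite zV !mulgA.
have zpow n : (Phi (z ^+ n)) = (1, (n : int)).
  elim: n => [|n IHn]; first by rewrite expg0 gmulf1.
  by rewrite expgS gmulfM IHn Phi_z; congr pair; rewrite /= mulg1.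
have Phi_inj : injective Phi.
  apply: gmulf_inj => u; have [l [m [n ->]]] := nf u.
  rewrite !gmulfM gmulfV !zpow Phi_psi => -[].
  rewrite /= invg1 !mulg1 => -> mn; rewrite gmulf1 mul1g.
  suff -> : m = n by rewrite mulgV.
  by have [] := @divg1_eq Zgroup _ _ (etrans (congr2 mulg (esym (mul1g _))
    erefl) mn).
have Phi_onto y : exists u, Phi u = y.
  case: y => l [n|n]; [exists (psi l * z ^+ n) | exists (psi l * z ^- n.+1)].
    by rewrite gmulfM Phi_psi zpow; congr pair; rewrite /= ?mulg1 //;
      apply: add0r.
  by rewrite gmulfM gmulfV Phi_psi zpow; congr pair;
    rewrite /= ?invg1 ?mulg1 //; apply: add0r.
have [g gK] := choice Phi_onto.
by exists Phi, g => // u; apply: Phi_inj; rewrite gK.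
Qed.
End AssociatedGroupIso.

(** Transport a lift of one element of the class by conjugation: this is well
    defined when the lifts of the elements of its centralizer centralize the
    lift. *)
Lemma class_section (gT : finGroupType) (G : {group gT}) (X : {set gT})
    (x0 : points X) (L : groupType) (k : UMagmaMorphism.type L gT) :
    X = val x0 ^: G -> X \subset G -> (forall g, g \in G -> exists l, k l = g) ->
    (forall h y, k y \in X -> commute (k h) (k y) -> commute h y) ->
  exists s : points X -> L, (forall x, k (s x) = val x) /\
    forall l x y, val y = k l * val x * (k l)^-1 -> s y = l * s x * l^-1.
Proof.
move=> defX sXG k_onto kC.
have [y0 y0E] : exists y, k y = val x0.
  exact/k_onto/(subsetP sXG)/(valP x0).
have conjV (H : groupType) (u v : H) : u * v * u^-1 = v ^ u^-1.
  by rewrite conjgE invgK mulgA.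
have /choice[t tE] (x : points X) : exists l, val x = val x0 ^ (k l)^-1.
  have /imsetP[g gG xE] : val x \in val x0 ^: G by rewrite -defX (valP x).
  by have [l lE] := k_onto _ (groupVr gG); exists l; rewrite lE invgK.
exists (fun x => y0 ^ (t x)^-1); split=> [x|l x y].
  by rewrite gmulfJ gmulfV y0E -tE.
rewrite !conjV {1}tE [in RHS]tE => yE.
have cm : commute y0 ((t y)^-1 * l * t x).
  apply/commute_sym/kC; first by rewrite y0E (valP x0).
  apply/commute_sym/commgP/conjg_fixP; rewrite !gmulfM gmulfV y0E !conjgM.
  by rewrite yE !conjgKV.
by move/commgP/conjg_fixP: cm; rewrite !conjgM =>
  /(canRL (conjgK _))/(canRL (conjgK _)).
Qed.

(** * The Schur multiplier of a group with a perfect central cover *)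

Section SchurMultiplierTheory.
Variables (gT : finGroupType) (X : {set gT}).
Local Notation E := (schur_cover X).
Local Notation FX := (free_group (points X)).
Local Notation FXR := (comm_pred (@full_pred FX) (ker_pred (proj (X := X)))).
Local Notation FXFX := (comm_pred (@full_pred FX) (@full_pred FX)).

(** The inclusion of the multiplier, with its type fixed once and for all:
    unification would otherwise unfold the groups involved. *)
Definition schur_val (u : schur_multiplier X) : E := val u.

Lemma schur_val_inj : injective schur_val.
Proof. exact: val_inj. Qed.

Lemma schur_valP (u : schur_multiplier X) :
  exists w, [/\ proj w = 1, w \in FXFX & schur_val u = qclass FXR w].
Proof. by have /asboolP[w /andP[/eqP w1 wC] uE] := valP u; exists w. Qed.

Lemma schur_val_onto (w : FX) : proj w = 1 -> w \in FXFX ->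
  exists m, schur_val m = qclass FXR w.
Proof.
move=> w1 wC.
suff wP : qclass FXR w \in
    qimage (N := FXR) (cap_pred (ker_pred (proj (X := X))) FXFX).
  by exists (exist (fun u => u \in qimage _) _ wP).
by apply/asboolP; exists w => //; apply/andP; split=> //; apply/eqP.
Qed.

Lemma schur_val_mu (x : points X) (g : gT) (h y : E) :
    g \in 'C[val x] -> cover_proj h = g -> cover_proj y = val x ->
  schur_val (mu x g) = h * y * h^-1 * y^-1.
Proof. exact: muE. Qed.

Lemma proj_gen (x : points X) : proj (free_gen x) = val x.
Proof. exact: free_lift_gen. Qed.

Lemma projM (u v : FX) : proj (u * v) = proj u * proj v.
Proof. exact: gmulfM. Qed.

Lemma projV (u : FX) : proj u^-1 = (proj u)^-1.
Proof. exact: gmulfV. Qed.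

Lemma coverM (u v : FX) : qclass FXR (u * v) = qclass FXR u * qclass FXR v.
Proof. exact: gmulfM. Qed.

Lemma coverV (u : FX) : qclass FXR u^-1 = (qclass FXR u)^-1.
Proof. exact: gmulfV. Qed.

Lemma coverR (u v : FX) : qclass FXR [~ u, v] = [~ qclass FXR u, qclass FXR v].
Proof. exact: gmulfR. Qed.

(** [L] is a perfect central cover of the group generated by [X], mapped by [psi]
    to F_X / [F_X, R_X]; the multiplier is then the image of its kernel. *)
Section CentralCover.
Variables (L : groupType) (k : UMagmaMorphism.type L gT).
Hypothesis perfL : perfect L.
Hypothesis k_ker : forall l m, k l = 1 -> commute l m.
Hypothesis k_X : forall x : points X, exists l, k l = val x.
Variable psi : UMagmaMorphism.type L E.
Hypothesis p_psi : forall l, cover_proj (psi l) = k l.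

Lemma cover_proj_im (e : E) : exists l, k l = cover_proj e.
Proof.
elim/qclassW: e => w; rewrite cover_projE.
elim/free_ind: w => [|x u [m mE]|x u [m mE]]; first by exists 1; rewrite !gmulf1.
  by have [l lE] := k_X x; exists (l * m); rewrite projM proj_gen gmulfM lE mE.
have [l lE] := k_X x; exists (l^-1 * m).
by rewrite projM projV proj_gen gmulfM gmulfV lE mE.
Qed.

(** Up to central factors, every element of F_X / [F_X, R_X] is a value of [psi];
    central factors do not change commutators. *)
Lemma schur_val_psi (u : schur_multiplier X) :
  exists2 l, k l = 1 & schur_val u = psi l.
Proof.
have [w [w1 wC uE]] := schur_valP u.
have [l lE] : exists l, qclass FXR w = psi l.
  clear uE w1; elim/comm_pred_ind: w / wC => [|x y [l xE]
    [m yE]|x [l xE]|x y _ _].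
  - by exists 1; rewrite !gmulf1.
  - by exists (l * m); rewrite coverM xE yE -gmulfM.
  - by exists l^-1; rewrite coverV xE -gmulfV.
  have [l lE] := cover_proj_im (qclass _ x).
  have [m mE] := cover_proj_im (qclass _ y).
  exists [~ l, m]; rewrite coverR [RHS]gmulfR.
  rewrite -[qclass _ x](mulVKg (psi l)) -[qclass _ y](mulVKg (psi m)).
  apply: comm_mul_central => v; apply: cover_ker_central;
    by rewrite cover_projM cover_projV p_psi ?lE ?mE mulVg.
by exists l; rewrite ?uE // -p_psi -lE cover_projE.
Qed.

(** As [L] is perfect, [psi] takes its values in the commutator subgroup. *)
Lemma psi_schur_val (l : L) : k l = 1 -> exists m, schur_val m = psi l.
Proof.
move=> kl1; have [w wC wE] : exists2 w, w \in FXFX & psi l = qclass FXR w.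
  move: l {kl1}; apply: (perfect_ind perfL) => [|x y [w wC xE]
    [v vC yE]|x [w wC xE]|x y].
  - by exists 1; rewrite ?gpred1 ?gmulf1.
  - by exists (w * v); rewrite ?gpredM // coverM -xE -yE -gmulfM.
  - by exists w^-1; rewrite ?gpredVr // coverV -xE -gmulfV.
  rewrite gmulfR; elim/qclassW: (psi x) => w; elim/qclassW: (psi y) => v.
  by exists [~ w, v]; rewrite ?coverR // comm_predR.
by rewrite wE; apply: schur_val_onto; rewrite // -cover_projE -wE p_psi.
Qed.

(** Lifting the generators arbitrarily to [L] gives a homomorphism from F_X that is
    trivial on [F_X, R_X], because the lift of [R_X] is central; it is a
    retraction of [psi] because [L] is perfect. *)
Lemma psi_inj : injective psi.
Proof.
have /choice[t tE] : forall x : points X, exists l, k l = val x by [].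
have [eta0 eta0E] : exists eta0 : UMagmaMorphism.type FX L,
    forall x, eta0 (free_gen x) = t x.
  by exists (free_lift t) => x; apply: free_lift_gen.
have kt w : k (eta0 w) = proj w.
  elim/free_ind: w => [|x u uE|x u uE]; first by rewrite !gmulf1.
    by rewrite projM proj_gen -uE -tE -eta0E -!gmulfM.
  by rewrite projM projV proj_gen -uE -tE -eta0E !gmulfM !gmulfV.
have kill r : r \in FXR -> eta0 r = 1.
  elim/comm_pred_ind: r / => [|x y xE yE|x xE|x y _ yK].
  - by rewrite gmulf1.
  - by rewrite gmulfM xE yE mulg1.
  - by rewrite gmulfV xE invg1.
  rewrite gmulfR; apply/eqP/commgP/commute_sym/k_ker.
  by rewrite kt; apply/eqP.
have [eta etaE] := quotient_lift kill.
have k_eta e : k (eta e) = cover_proj e.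
  by elim/qclassW: e => w; rewrite etaE kt cover_projE.
have [f fE] : exists f : UMagmaMorphism.type L L, forall l, f l = eta (psi l).
  by apply: hom_of_morph => l m; rewrite !gmulfM.
apply: (can_inj (g := eta)) => l; rewrite -fE.
apply: (perfect_hom_eq (g := idfun) perfL) => m e; apply: k_ker.
by rewrite gmulfM gmulfV fE k_eta p_psi mulVg.
Qed.
End CentralCover.
End SchurMultiplierTheory.

(** * The classes of PSL(2,q) *)

Section Classes.
Variable F : finFieldType.
Local Notation Z := ('Z(SL2 F)).
Local Notation SL := ([subg SL2_group F]%type).
Local Notation PSL := ([subg PSL2_group F]%type).
Variable X : {set coset_of Z}.
Hypothesis q4 : 4 < #|F|.
Hypothesis q9 : #|F| != 9.
Hypothesis clX : X \in classes (PSL2 F).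
Hypothesis ntX : X != 1.

Lemma class_point : exists x : points X, X = val x ^: PSL2 F.
Proof.
have /imsetP[x xG defX] := clX.
have xX : x \in X by rewrite defX class_refl.
by exists (exist (fun a => a \in X) x xX).
Qed.

Lemma class_sub_PSL2 : X \subset PSL2 F.
Proof. by have /imsetP[x xG ->] := clX; rewrite class_subG. Qed.

Lemma point_lift (x : points X) : exists2 B, (\det B = 1)%R & val x = PSL2_mx B.
Proof. exact/PSL2P/(subsetP class_sub_PSL2)/(valP x). Qed.

(** As [X] generates PSL(2,q), a homomorphism that takes all the values of
    [X] is onto, and the lifting theorem applies to it. *)
Lemma class_central_lift (E : groupType)
    (p : UMagmaMorphism.type E (coset_of Z)) (e : points X -> E) :
    (forall u v, p u = 1 -> commute u v) -> (forall x, p (e x) = val x) ->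
  exists psi : UMagmaMorphism.type SL E,
    forall l, p (psi l) = PSL2_mx (GLval (sgval l)).
Proof.
move=> pC pe; have [A dA|phi [phiM p_phi]] := SL2_central_lift q4 q9 pC
  (@PSL2_mxM F).
  pose S := [set g | `[< exists u, p u = g >]].
  have gS : group_set S.
    apply/group_setP; split=> [|g h].
      by rewrite inE; apply/asboolP; exists 1; rewrite gmulf1.
    rewrite !inE => /asboolP[u uE] /asboolP[v vE]; apply/asboolP; exists (u * v).
    by rewrite gmulfM uE vE.
  suff : PSL2_mx A \in Group gS by rewrite inE => /asboolP.
  have := PSL2_mx_in dA; rewrite -(class_gen q4 clX ntX); apply: subsetP.
  rewrite gen_subG; apply/subsetP => x xX; rewrite inE; apply/asboolP.
  by exists (e (exist (fun a => a \in X) x xX)); rewrite pe.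
have [|psi psiE] := @hom_of_morph SL E (fun l => phi (GLval (sgval l))).
  by move=> g h; rewrite -phiM ?SL2_det ?subgP.
by exists psi => l; rewrite psiE p_phi // SL2_det ?subgP.
Qed.

(** The commutator of lifts of commuting elements is [1] or [-1]; if it is [-1]
    then [B] is conjugate to [- B], so that [B] has trace zero. *)
Lemma lifts_commute A B : ~~ odd #|F| \/ X != involutions (PSL2 F) ->
    (\det A = 1)%R -> (\det B = 1)%R -> PSL2_mx B \in X ->
    commute (PSL2_mx A) (PSL2_mx B) -> (A *m B = B *m A)%R.
Proof.
move=> evX dA dB BX; rewrite /commute -!PSL2_mxM // => /PSL2_mx_eq[].
- by rewrite det_mulmx dA dB mulr1.
- by rewrite det_mulmx dA dB mulr1.
- by [].
move=> AB; have [ev|od] := boolP (odd #|F|); last by rewrite AB oppmx_char2.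
have nz2 : (2 != 0 :> F)%R by rewrite -odd_card_finField.
case: evX => [|/eqP[]]; first by rewrite ev.
apply: (involution_class nz2 clX dB BX).
have uA : A \in unitmx by rewrite unitmxE dA unitr1.
have : (\tr B = - \tr B)%R.
  by rewrite -[in LHS](mulKmx uA B) AB mulmxN raddfN /= mxtrace_mulC mulmxK.
move/eqP; rewrite -subr_eq0 opprK -mulr2n -mulr_natl mulf_eq0 (negPf nz2).
by move/eqP.
Qed.

Lemma involution_anticommuting (x : points X) :
    X = involutions (PSL2 F) -> (2 != 0 :> F)%R ->
  exists2 B, (\det B = 1)%R & exists2 C, (\det C = 1)%R &
    val x = PSL2_mx B /\ (B *m C = - (C *m B))%R.
Proof.
move=> invX nz2; have [B dB xB] := point_lift x.
have : val x \in involutions (PSL2 F) by rewrite -invX (valP x).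
rewrite inE xB => /andP[_ /eqP/(PSL2_mx_order2 nz2 dB) trB].
by have [C dC BC] := anticommuting nz2 dB trB; exists B => //; exists C.
Qed.

Lemma PSL2_mx_anticommuting (B C : 'M[F]_2) :
    (\det B = 1)%R -> (\det C = 1)%R -> (B *m C = - (C *m B))%R ->
  commute (PSL2_mx C) (PSL2_mx B).
Proof.
move=> dB dC BC; rewrite /commute -!PSL2_mxM // BC.
rewrite -[X in PSL2_mx (- X)%R]mul1mx -mulNmx.
have dCB : (\det (C *m B) = 1)%R by rewrite det_mulmx dB dC mulr1.
rewrite [RHS]PSL2_mxM ?detN1 // (_ : PSL2_mx (- 1%:M)%R = 1) ?mul1g //.
by apply/(PSL2_mx_eq1 (detN1 F)); right.
Qed.

(** * The associated groups of the classes of PSL(2,q) *)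

Lemma rack_proj :
  exists p : UMagmaMorphism.type (associated_group X) (coset_of Z),
    forall x, p (rack_gen x) = val x.
Proof. exact: rack_lift. Qed.

Lemma associated_group_SL2 : ~~ odd #|F| \/ X != involutions (PSL2 F) ->
  group_iso (associated_group X) (SL * Zgroup)%type.
Proof.
move=> evX; have [x0 defX] := class_point; have [k kE] := SL2_proj_hom F.
have k_onto := SL2_proj_onto kE; have k_ker := SL2_proj_ker kE.
have [s [ks sJ]] : exists s : points X -> SL, (forall x, k (s x) = val x) /\
    forall l x y, val y = k l * val x * (k l)^-1 -> s y = l * s x * l^-1.
  apply: class_section defX class_sub_PSL2 k_onto _ => h y.
  rewrite !kE => yX com; rewrite /commute -[h]SL2_mxK -[y]SL2_mxK.
  rewrite -!SL2_mxM ?SL2_det ?subgP //; congr SL2_mx.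
  by apply: lifts_commute com; rewrite ?SL2_det ?subgP.
have [p p_gen] := rack_proj.
have pC := rack_ker_central p_gen (class_closed defX class_sub_PSL2).
have [psi p_psi] := class_central_lift pC p_gen.
apply: (associated_group_iso defX class_sub_PSL2 p_gen (SL2_perfect q4) k_onto
  k_ker ks sJ (psi := psi)).
by move=> l; rewrite kE p_psi.
Qed.

Lemma associated_group_PSL2 : odd #|F| -> X = involutions (PSL2 F) ->
  group_iso (associated_group X) (PSL * Zgroup)%type.
Proof.
rewrite odd_card_finField => nz2 invX; have [x0 defX] := class_point.
have [p p_gen] := rack_proj.
have XJ := class_closed defX class_sub_PSL2.
have pC := rack_ker_central p_gen XJ.
have [psi0 p_psi0] := class_central_lift pC p_gen.
pose phi (A : 'M[F]_2) := psi0 (SL2_mx A).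
have phiM A B : (\det A = 1)%R -> (\det B = 1)%R ->
    phi (A *m B)%R = phi A * phi B.
  by move=> dA dB; rewrite /phi SL2_mxM // gmulfM.
have p_phi A : (\det A = 1)%R -> p (phi A) = PSL2_mx A.
  by move=> dA; rewrite p_psi0 SL2_mxE.
(* The lift of an involution differs by a central factor from a generator of
   As(X), with which [phi C] commutes as soon as its image in PSL(2,q) does. *)
have phiN1 : phi (- 1%:M)%R = 1.
  have [B dB [C dC [xB BC]]] := involution_anticommuting x0 invX nz2.
  have com : commute (phi C) (rack_gen x0).
    have xC : val x0 = p (phi C) * val x0 * (p (phi C))^-1.
      by rewrite p_phi // xB (PSL2_mx_anticommuting dB dC BC) mulgK.
    by rewrite /commute [in RHS](rack_gen_act p_gen XJ xC) mulgVK.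
  have comB : commute (phi C) (phi B).
    rewrite -[phi B](mulVKg (rack_gen x0)); apply: commuteM => //.
    by apply/commute_sym/pC; rewrite gmulfM gmulfV p_phi // p_gen xB mulVg.
  have e1 : phi (- (C *m B))%R = phi (- 1%:M)%R * phi (C *m B)%R.
    by rewrite -phiM ?detN1 ?det_mulmx ?dC ?dB ?mulr1 // mulNmx mul1mx.
  have e2 : phi C * phi B = phi (- (C *m B))%R by rewrite comB -phiM // BC.
  by apply: (mulIg (phi (C *m B)%R)); rewrite -e1 -e2 mul1g phiM.
have phi_eq A B : (\det A = 1)%R -> (\det B = 1)%R ->
    PSL2_mx A = PSL2_mx B -> phi A = phi B.
  move=> dA dB eAB; have [-> //|->] := PSL2_mx_eq dA dB eAB.
  by rewrite -[X in phi (- X)%R]mul1mx -mulNmx phiM ?detN1 // phiN1 mul1g.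
have [k kE] : exists k : UMagmaMorphism.type PSL (coset_of Z),
    forall l, k l = sgval l.
  by apply: hom_of_morph.
have k_onto g : g \in PSL2 F -> exists l, k l = g.
  by move=> gG; exists (subg _ g); rewrite kE subgK.
have k_inj : injective k by move=> l m; rewrite !kE => /val_inj.
have k_ker l m : k l = 1 -> commute l m.
  move=> kl1; have -> : l = 1 by apply: k_inj; rewrite kl1 gmulf1.
  exact/commute_sym/commute1.
have /choice[t tP] (l : PSL) : exists A, (\det A = 1)%R /\ sgval l = PSL2_mx A.
  by have /PSL2P[A dA lE] := subgP l; exists A.
have [psi psiE] : exists psi : UMagmaMorphism.type PSL (associated_group X),
    forall l, psi l = phi (t l).
  apply: hom_of_morph => l m; have [dl lE] := tP l; have [dm mE] := tP m.
  have [dlm lmE] := tP (l * m); rewrite -phiM //; apply: phi_eq => //.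
    by rewrite det_mulmx dl dm mulr1.
  by rewrite -lmE PSL2_mxM // -lE -mE.
pose s (x : points X) : PSL := subg _ (val x).
have ks x : k (s x) = val x.
  by rewrite kE subgK // (subsetP class_sub_PSL2 _ (valP x)).
have sJ l x y : val y = k l * val x * (k l)^-1 -> s y = l * s x * l^-1.
  by move=> yE; apply: k_inj; rewrite !gmulfM gmulfV !ks.
apply: (associated_group_iso defX class_sub_PSL2 p_gen (PSL2_perfect q4) k_onto
  k_ker ks sJ (psi := psi)).
by move=> l; have [dl lE] := tP l; rewrite psiE kE p_phi.
Qed.

(** * The relative Schur multipliers of PSL(2,q) *)

Local Notation minus_one := (SL2_mx (- 1%:M : 'M[F]_2)%R).

Lemma schur_cover_lift : exists psi : UMagmaMorphism.type SL (schur_cover X),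
  forall l, cover_proj (psi l) = PSL2_mx (GLval (sgval l)).
Proof.
exact: class_central_lift (@cover_ker_central _ X) (@cover_proj_gen _ X).
Qed.

Section WithLift.
Variable psi : UMagmaMorphism.type SL (schur_cover X).
Hypothesis p_psi : forall l, cover_proj (psi l) = PSL2_mx (GLval (sgval l)).

Let p_psi_mx A : (\det A = 1)%R -> cover_proj (psi (SL2_mx A)) = PSL2_mx A.
Proof. by move=> dA; rewrite p_psi SL2_mxE. Qed.

Let k_X (k : UMagmaMorphism.type SL (coset_of Z)) :
    (forall l, k l = PSL2_mx (GLval (sgval l))) ->
  forall x : points X, exists l, k l = val x.
Proof.
by move=> kE x; apply/(SL2_proj_onto kE)/(subsetP class_sub_PSL2)/(valP x).
Qed.

(** The kernel of the projection of SL(2,q) onto PSL(2,q) is {1, -1}. *)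
Lemma schur_val_minus_one (u : schur_multiplier X) :
  u = 1 \/ schur_val u = psi minus_one.
Proof.
have [k kE] := SL2_proj_hom F.
have p_psi' l : cover_proj (psi l) = k l by rewrite p_psi kE.
have [l kl1 uE] := schur_val_psi (k_X kE) p_psi' u.
rewrite kE in kl1.
have [lE|lE] := (PSL2_mx_eq1 (SL2_det (subgP l))).1 kl1; [left | right].
  by apply: schur_val_inj; rewrite uE -[l]SL2_mxK lE SL2_mx1 gmulf1.
by rewrite uE -[l]SL2_mxK lE.
Qed.

Lemma schur_minus_one : exists m : schur_multiplier X, schur_val m = psi
  minus_one.
Proof.
have [k kE] := SL2_proj_hom F.
have p_psi' l : cover_proj (psi l) = k l by rewrite p_psi kE.
apply: (psi_schur_val (SL2_perfect q4) p_psi').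
by rewrite -p_psi' p_psi_mx ?detN1 //; apply/(PSL2_mx_eq1 (detN1 F)); right.
Qed.

Lemma psi_minus_one_neq1 : (2 != 0 :> F)%R -> psi minus_one != 1.
Proof.
move=> nz2; have [k kE] := SL2_proj_hom F.
have p_psi' l : cover_proj (psi l) = k l by rewrite p_psi kE.
apply: contra_neq nz2 => psiN1; have : psi minus_one = psi 1 by rewrite gmulf1.
move/(psi_inj (SL2_perfect q4) (SL2_proj_ker kE) (k_X kE) p_psi').
move/(congr1 (fun l : SL => GLval (sgval l) 0%R 0%R)).
by rewrite SL2_mxE ?detN1 // !mxE /= => N1; rewrite -(addNr (1 : F)%R) N1.
Qed.

Lemma schur_val_mu_mx (x : points X) B C :
    (\det B = 1)%R -> (\det C = 1)%R -> val x = PSL2_mx B ->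
    PSL2_mx C \in 'C[val x] ->
  schur_val (mu x (PSL2_mx C)) = psi (SL2_mx C) * psi (SL2_mx B) *
    (psi (SL2_mx C))^-1 * (psi (SL2_mx B))^-1.
Proof.
by move=> dB dC xB Cx; apply: schur_val_mu; rewrite // p_psi_mx // xB.
Qed.
End WithLift.

Lemma relative_schur_trivial_even (x : points X) : ~~ odd #|F| ->
  trivial_group (relative_schur_multiplier (PSL2_group F) x).
Proof.
move=> ev; have [psi p_psi] := schur_cover_lift.
elim/qclassW=> u; suff -> : u = 1 by rewrite gmulf1.
have [//|uE] := schur_val_minus_one p_psi u.
by apply: schur_val_inj; rewrite uE oppmx_char2 // SL2_mx1 gmulf1.
Qed.

(** -1 is the commutator of a lift of the involution [x] with a matrix that
    anticommutes with it. *)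
Lemma relative_schur_trivial_involutions (x : points X) :
    odd #|F| -> X = involutions (PSL2 F) ->
  trivial_group (relative_schur_multiplier (PSL2_group F) x).
Proof.
rewrite odd_card_finField => nz2 invX; have [psi p_psi] := schur_cover_lift.
elim/qclassW=> u; apply/eqP; rewrite qclass_eq1.
have [->|uE] := schur_val_minus_one p_psi u; first exact: gpred1.
have [B dB [C dC [xB BC]]] := involution_anticommuting x invX nz2.
have Cx : PSL2_mx C \in 'C[val x].
  by apply/cent1P; rewrite xB; apply: PSL2_mx_anticommuting BC.
apply/mu_imageP; exists (PSL2_mx C); first by rewrite inE Cx PSL2_mx_in.
apply: schur_val_inj; rewrite (schur_val_mu_mx p_psi dB dC xB Cx) uE.
have -> : psi (SL2_mx C) * psi (SL2_mx B) =
    psi minus_one * (psi (SL2_mx B) * psi (SL2_mx C)).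
  rewrite -!gmulfM -!SL2_mxM ?detN1 ?det_mulmx ?dB ?dC ?mulr1 //.
  by rewrite BC mulNmx mul1mx opprK.
by rewrite !mulgA !mulgK.
Qed.

(** All the commutators that define [mu x] are trivial, and M(G) has order 2. *)
Lemma relative_schur_Z2 (x : points X) :
    odd #|F| -> X != involutions (PSL2 F) ->
  group_iso (relative_schur_multiplier (PSL2_group F) x) 'Z_2.
Proof.
move=> od ninvX; have [psi p_psi] := schur_cover_lift.
have [m mE] := schur_minus_one p_psi.
have mu_trivial u : u \in mu_image (PSL2_group F) x -> u = 1.
  case/mu_imageP=> g /setIP[/PSL2P[C dC ->] Cx] ->.
  have [B dB xB] := point_lift x.
  apply: schur_val_inj; rewrite (schur_val_mu_mx p_psi dB dC xB Cx).
  have CB : (C *m B = B *m C)%R.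
    apply: lifts_commute => //; [by right | by rewrite -xB (valP x) |].
    by rewrite -xB; apply/cent1P.
  rewrite -[psi (SL2_mx C) * _]gmulfM -SL2_mxM // CB SL2_mxM // gmulfM.
  by rewrite mulgK mulgV.
apply: (@two_element_group _ (qclass _ m)).
  rewrite qclass_eq1; apply/negP => /mu_trivial m1.
  rewrite odd_card_finField in od.
  by have := psi_minus_one_neq1 p_psi od; rewrite -mE m1 eqxx.
elim/qclassW=> u; have [->|uE] := schur_val_minus_one p_psi u.
  by left; apply: gmulf1.
by right; congr qclass; apply: schur_val_inj; rewrite uE mE.
Qed.
End Classes.

Theorem theorem6p11 (q : nat) (F : finFieldType)
    (X : {set coset_of 'Z(SL2 F)}) :
  #|F| = q -> 4 < q -> q != 9 ->
  X \in classes (PSL2 F) -> X != 1 ->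
  (forall x : points X,
     [/\ ~~ odd q ->
           trivial_group (relative_schur_multiplier (PSL2_group F) x),
         odd q -> X = involutions (PSL2 F) ->
           trivial_group (relative_schur_multiplier (PSL2_group F) x)
       & odd q -> X != involutions (PSL2 F) ->
           group_iso (relative_schur_multiplier (PSL2_group F) x) 'Z_2]) /\
  ((~~ odd q \/ X != involutions (PSL2 F) ->
      group_iso (associated_group X) ([subg SL2_group F] * Zgroup)%type) /\
   (odd q -> X = involutions (PSL2 F) ->
      group_iso (associated_group X) ([subg PSL2_group F] * Zgroup)%type)).
Proof.
move=> <- q4 q9 clX ntX; split; last first.
  by split; [apply: associated_group_SL2 | apply: associated_group_PSL2].
move=> x; split; first exact: relative_schur_trivial_even.
  exact: relative_schur_trivial_involutions.
exact: relative_schur_Z2.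
Qed.
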